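(* Let $\lambda>0$, let $\mathbf{u}_0\in L^2(\Omega)$ be curl-free, and let $\mathbf{u}(\cdot;\mathbf{u}_0)$ denote the corresponding unique smooth solution of the 2D Kuramoto--Sivashinsky equation $$\partial_t\mathbf{u}+\mathbf{u}\cdot\nabla\mathbf{u}=-\Delta^2\mathbf{u}-\lambda\Delta\mathbf{u},\qquad \nabla^\perp\cdot\mathbf{u}=0,$$ with initial data $\mathbf{u}_0$ over its maximal interval of existence $(0,T^* )$. Given $\alpha\in[0,2)$, let $$N_\alpha(t;\mathbf{u}_0)=\left[C_*\left(\|\mathbf{u}(t;\mathbf{u}_0)\|_{H^{-\alpha}}^2+N_*\right)\right]^{\frac{1}{2-\alpha}},$$ where $C_*=C_*(\alpha)>0$ is a universal constant with the property (P) described in the context and $N_*>0$ satisfies $C_*N_*\ge1$. Then $\mathbf{u}(\cdot;\mathbf{u}_0)$ is globally regular if and only if $N_\alpha(\cdot;\mathbf{u}_0)\in L^4(0,T^* )$.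
   Context: $\Omega=[0,2\pi]^2$ with periodic boundary conditions; all functions are $2\pi$-periodic in each direction. $\nabla^\perp=(-\partial_2,\partial_1)$; $\mathbf{u}_0$ curl-free means $\nabla^\perp\cdot\mathbf{u}_0=0$ in the sense of distributions. Fourier coefficients: $\hat\varphi_\ell=(2\pi)^{-2}\int_\Omega\varphi(x)e^{-i\ell\cdot x}dx$, $\ell\in\mathbb{Z}^2$. For real $\kappa$, $H^\kappa$ is the (inhomogeneous) periodic Sobolev space with norm, up to equivalence, $\|\varphi\|_{H^\kappa}=\big((2\pi)^2\sum_{\ell\in\mathbb{Z}^2}(1+|\ell|^2)^\kappa|\hat\varphi_\ell|^2\big)^{1/2}$, for scalar- or vector-valued functions. For $N>0$, $P_N$ denotes the projection onto Fourier modes with wavenumbers $|k|\le N$. Solutions: for curl-free $\mathbf{u}_0\in L^2$ there is $T_0>0$ and a unique solution $\mathbf{u}\in C_w([0,T_0];L^2)\cap L^2(0,T_0;H^2)$ (where $C_w$ denotes weak continuity in time), which is $C^\infty$ in space for every $t\in(0,T_0]$. $T^*$ denotes its maximal time of existence; if $\sup_{t\in[0,T^* )}\|\mathbf{u}(t)\|_{L^2}<\infty$, then $T^*=\infty$. ''Globally regular'' means $T^*=\infty$ (so that the solution is smooth for all $t>0$). Divergence: $\delta=\nabla\cdot\mathbf{u}$; for a scalar function $f(t,x)$, $f_+^*(t)=\sup_{x\in\Omega}\max\{0,f(t,x)\}$. Property (P) of the constant $C_*$: $C_*$ is independent of the initial data and of $T^*$, and for every $N_*>0$ with $C_*N_*\geq1$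 and every curl-free initial datum $\mathbf{u}_0\in L^2$, if $\limsup_{t\to T^*-}\int_0^t(P_{N_\alpha(s;\mathbf{u}_0)}\delta)_+^*(s)\,ds<\infty$, then $\sup_{t\in[0,T^* )}\|\mathbf{u}(t;\mathbf{u}_0)\|_{L^2}<\infty$ and, subsequently, $T^*=\infty$; conversely, if this condition fails, then $\limsup_{t\to T^*-}\|\mathbf{u}(t;\mathbf{u}_0)\|_{H^3}$ is infinite.
   Formalization: When T* is infinite, N_α ≥ 1 is never in L^4(0,∞) (e.g. u_0 = 0), so ''N_α in L^4(0,T* )'' is read as N_α in L^4(0,min(S,T* )) for every finite S; for finite T* this is exactly L^4(0,T* ). *)

(* Defs.v *)
From mathcomp Require Import all_boot all_order all_algebra.
From mathcomp Require Import all_classical all_reals all_analysis.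
From mathcomp Require Import complex.

Set Implicit Arguments.
Unset Strict Implicit.
Unset Printing Implicit Defensive.

Import Order.TTheory GRing.Theory Num.Theory.
Import numFieldNormedType.Exports.

Local Open Scope classical_set_scope.
Local Open Scope ring_scope.
Local Open Scope complex_scope.

Section Torus.
Context {R : realType}.

Definition mu2 : {measure set (measurableTypeR R * measurableTypeR R) -> \bar R} :=
  (lebesgue_measure \x lebesgue_measure)%E.

Definition Omega : set (R * R) := `[0, 2 * pi] `*` `[0, 2 * pi].

Definition periodic2 (f : R * R -> R) : Prop :=
  forall x : R * R, f (x.1 + 2 * pi, x.2) = f x /\ f (x.1, x.2 + 2 * pi) = f x.

Definition intOmega (f : R * R -> R) : R := (\int[mu2]_(x in Omega) f x)%R.

Definition L2fun (f : R * R -> R) : Prop :=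
  [/\ periodic2 f, measurable_fun setT f &
      (\int[mu2]_(x in Omega) ((f x) ^+ 2)%:E < +oo)%E].

Definition vfield := 'I_2 -> R * R -> R.

Definition L2field (u : vfield) : Prop := forall i, L2fun (u i).

Definition L2norm (u : vfield) : \bar R :=
  ((\int[mu2]_(x in Omega) (\sum_i (u i x) ^+ 2)%:E) `^ 2^-1)%E.

Definition evec (i : 'I_2) : R * R := if i == ord0 then (1, 0) else (0, 1).

Definition partial (i : 'I_2) (f : R * R -> R) : R * R -> R :=
  fun x => 'D_(evec i) f x.

Definition smooth (f : R * R -> R) : Prop :=
  forall s : seq 'I_2, continuous (foldr partial f s) /\
    forall i x, derivable (foldr partial f s) x (evec i).

Definition laplacian (f : R * R -> R) : R * R -> R :=
  fun x => \sum_i partial i (partial i f) x.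

Definition divergence (u : vfield) : R * R -> R :=
  fun x => \sum_i partial i (u i) x.

Definition gradperp (f : R * R -> R) : vfield :=
  fun i x => if i == ord0 then - partial ord_max f x else partial ord0 f x.

(* gradperp . u = 0 in the sense of distributions on the torus. *)
Definition curl_free (u : vfield) : Prop :=
  forall phi, periodic2 phi -> smooth phi ->
    intOmega (fun x => \sum_i u i x * gradperp phi i x) = 0.

Definition expi (a : R) : R[i] := (cos a +i* sin a).

Definition phase (l : int * int) (x : R * R) : R := l.1%:~R * x.1 + l.2%:~R * x.2.

Definition fourier (f : R * R -> R) (l : int * int) : R[i] :=
  let g x := (f x)%:C * expi (- phase l x) in
  ((2 * pi) ^- 2)%:C *
  (intOmega (fun x => complex.Re (g x)) +i* intOmega (fun x => complex.Im (g x))).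

Definition freqsq (l : int * int) : R := l.1%:~R ^+ 2 + l.2%:~R ^+ 2.

(* The Sobolev norm of order k, for any real k; it takes the value +oo on
   fields that are not in H^k. *)
Definition Hnorm (k : R) (u : vfield) : \bar R :=
  ((((2 * pi) ^+ 2)%:E *
    \esum_(l in [set: int * int])
      ((1 + freqsq l) `^ k *
       \sum_i ComplexField.Normc.normc (fourier (u i) l) ^+ 2)%:E) `^ 2^-1)%E.

(* For real-valued f the sum is real, as the set of modes is symmetric. *)
Definition PN (N : R) (f : R * R -> R) : R * R -> R := fun x =>
  complex.Re (\sum_(l \in [set l : int * int | Num.sqrt (freqsq l) <= N])
    fourier f l * expi (phase l x)).

Definition sup_pos (f : R * R -> R) : \bar R :=
  ereal_sup [set (Num.max 0 (f x))%:E | x in Omega].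

Definition trajectory := R -> vfield.

Definition weakly_continuous (u : trajectory) (T : \bar R) : Prop :=
  forall g : vfield, L2field g ->
  {within [set t : R | 0 <= t /\ (t%:E < T)%E],
    continuous (fun t => intOmega (fun x => \sum_i u t i x * g i x))}.

(* Solutions on [0, T), 0 < T <= +oo, in the class
   C_w([0, S]; L^2) /\ L^2(0, S; H^2) for all S < T. For positive times u t
   denotes the smooth representative, for which the equation and the curl-free
   condition hold pointwise; the initial datum is attained in L^2, that is,
   almost everywhere. *)
Definition KS_solution (lambda : R) (u0 : vfield) (T : \bar R)
    (u : trajectory) : Prop :=
  [/\ (0 < T)%E,
      (forall t, 0 <= t -> (t%:E < T)%E -> L2field (u t)) /\
      (forall i, {ae mu2, forall x, u 0 i x = u0 i x}),
      weakly_continuous u T,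
      (forall S : R, 0 < S -> (S%:E < T)%E ->
        (\int[lebesgue_measure]_(t in `]0%R, S[) (Hnorm 2 (u t) `^ 2) < +oo)%E) &
      forall t, 0 < t -> (t%:E < T)%E ->
        [/\ forall i, smooth (u t i),
            forall x, - partial ord_max (u t ord0) x
                      + partial ord0 (u t ord_max) x = 0 &
            forall i x, is_derive t 1 (fun s => u s i x)
              (- (\sum_j u t j x * partial j (u t i) x)
               - laplacian (laplacian (u t i)) x
               - lambda * laplacian (u t i) x)]].

(* T is the maximal time of existence and u the solution on [0, T). *)
Definition KS_maximal (lambda : R) (u0 : vfield) (T : \bar R)
    (u : trajectory) : Prop :=
  KS_solution lambda u0 T u /\
  forall T' v, KS_solution lambda u0 T' v -> (T' <= T)%E.

Definition globally_regular (T : \bar R) : Prop := T = +oo%E.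

(* The norm is finite for 0 <= t < T, since alpha >= 0 and u t is in L^2. *)
Definition Nalpha (alpha C Nst : R) (u : trajectory) (t : R) : R :=
  (C * (fine (Hnorm (- alpha) (u t)) ^+ 2 + Nst)) `^ (2 - alpha)^-1.

Definition left_of (T : \bar R) : set_system R :=
  match T with
  | r%:E => at_left r
  | +oo => pinfty_nbhs R
  | -oo => ninfty_nbhs R
  end%E.

Definition divergence_condition (alpha C Nst : R) (u : trajectory)
    (T : \bar R) : Prop :=
  (limf_esup (fun t : R => \int[lebesgue_measure]_(s in `]0%R, t[)
      sup_pos (PN (Nalpha alpha C Nst u s) (divergence (u s))))
    (left_of T) < +oo)%E.

(* The property required of the constant C_*. In the converse part T is
   finite: over an infinite horizon the time integral can also diverge along
   bounded solutions such as non-constant steady states. *)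
Definition propertyP (lambda alpha C : R) : Prop :=
  forall (Nst : R) (u0 : vfield) (T : \bar R) (u : trajectory),
    0 < Nst -> 1 <= C * Nst ->
    L2field u0 -> curl_free u0 -> KS_maximal lambda u0 T u ->
    (divergence_condition alpha C Nst u T ->
      (ereal_sup [set L2norm (u t) | t in [set t : R | (0 <= t)%R /\ (t%:E < T)%E]]
         < +oo)%E /\ T = +oo%E) /\
    ((T < +oo)%E -> ~ divergence_condition alpha C Nst u T ->
      limf_esup (fun t => Hnorm 3 (u t)) (left_of T) = +oo%E).

Definition L4_on (D : set R) (f : R -> R) : Prop :=
  measurable_fun D f /\ (\int[lebesgue_measure]_(t in D) (`|f t| ^+ 4)%:E < +oo)%E.

(* f is in L^4(0, min(S, T)) for all finite S; when T is finite this is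
   L^4(0, T), and when T = +oo integrability is required on bounded time
   intervals (N_alpha >= 1 is never in L^4(0, +oo)). *)
Definition L4_until (T : \bar R) (f : R -> R) : Prop :=
  forall S : R, L4_on [set t : R | [/\ 0 < t, t < S & (t%:E < T)%E]] f.

End Torus.

(* Main.v *)
Require Import Defs.
From mathcomp Require Import all_boot all_order all_algebra.
From mathcomp Require Import finmap complex.
From mathcomp Require Import all_classical all_reals all_analysis.
From mathcomp Require Import measurable_realfun zify ring lra.

(** Why the theorem holds.

    Integrability of [N_alpha]^4 implies global regularity.  Suppose [T] is
    finite.  By property (P) it is enough to bound the time integral of the
    supremum of the low-mode divergence.  At a fixed time write [N] for
    [N_alpha >= 1] and [h] for the [H^-alpha] norm.  At most [9 N^2] modes
    satisfy [|l| <= N]; a Fourier coefficient of the divergence is, after an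
    integration by parts, at most [|l|] times that of the field.  Summing
    Young's inequality with parameter [N^2] over these modes gives
    a bound [O(N^4) + O(N^(2 alpha) h^2)].  The very definition of [N_alpha]
    says [h^2 <= N^(2 - alpha) / C], and [2 alpha + (2 - alpha) <= 4], so the
    supremum is [O(N^4)] ([sup_pos_le]), which is integrable on [(0, T)].

    Global regularity implies local integrability of [N_alpha]^4.  Here it
    suffices that [h] is measurable and locally bounded in time.  Fourier
    coefficients are continuous in time because the solution is weakly
    continuous, and [h^2] is a countable sum of their weighted squares, hence
    measurable ([measurable_Hnorm_sqr]).  For the bound, [h] is at most the
    [L^2] norm by Bessel's inequality ([Bessel], [Hnorm_le_energy]).  A weakly
    continuous curve is tested by each fixed [L^2] function into a bounded set
    over a compact time interval, so its [L^2] norm is bounded there by the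
    uniform boundedness principle, proved by a gliding hump
    ([L2_uniform_boundedness], [energy_bounded]).

    Bessel's inequality is needed in the first half too: it makes the
    [H^-alpha] norm finite, so that its finite real part dominates the low
    modes ([Hnorm_ge_modes]). *)

Set Implicit Arguments.
Unset Strict Implicit.
Unset Printing Implicit Defensive.

Import Order.TTheory GRing.Theory Num.Theory.
Import numFieldNormedType.Exports.
Local Open Scope classical_set_scope.
Local Open Scope ring_scope.

(** The measurable structure carrying [mu2]; the one inferred on [R * R] is
    convertible to it but has another display. *)
Local Notation plane R := (measurableTypeR R * measurableTypeR R)%type.

(** * Square-integrable functions and uniform boundedness *)

Section SquareIntegrable.
Context d (T : measurableType d) (R : realType).
Context (mu : {measure set T -> \bar R}) (D : set T) (mD : measurable D).
Implicit Types f g h : T -> R.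

Definition sqint f :=
  measurable_fun D f /\ (\int[mu]_(x in D) ((f x) ^+ 2)%:E < +oo)%E.

Definition inner f g : R := \int[mu]_(x in D) (f x * g x).

Lemma sqint_integrable_mul f g : sqint f -> sqint g ->
  mu.-integrable D (fun x => (f x * g x)%:E).
Proof.
move=> [mf If] [mg Ig].
apply: (@le_integrable _ _ _ mu D mD _ (fun x => ((f x) ^+ 2)%:E + ((g x) ^+ 2)%:E)%E).
- by apply/measurable_EFinP; exact: measurable_funM.
- move=> x _ /=; rewrite lee_fin normrM.
  rewrite [leRHS]ger0_norm ?addr_ge0 ?sqr_ge0// -[f x ^+ 2]real_normK ?num_real//.
  rewrite -[g x ^+ 2]real_normK ?num_real//.
  have := sqr_ge0 (`|f x| - `|g x|); have := normr_ge0 (f x); have := normr_ge0 (g x); nra.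
- have sq h : measurable_fun D h -> (\int[mu]_(x in D) ((h x) ^+ 2)%:E < +oo)%E ->
      mu.-integrable D (fun x => ((h x) ^+ 2)%:E).
    move=> mh Ih; apply/integrableP; split.
      by apply/measurable_EFinP; exact: measurable_funX.
    by under eq_integral do rewrite gee0_abs ?lee_fin ?sqr_ge0//.
  by apply: integrableD => //; exact: sq.
Qed.

Lemma integrable_mul_sqint f : measurable_fun D f ->
  mu.-integrable D (fun x => (f x * f x)%:E) -> sqint f.
Proof.
move=> mf /integrableP[_ If]; split => //.
rewrite (eq_integral (fun x => `|(f x * f x)%:E|%E))// => x _.
by rewrite gee0_abs ?lee_fin -?expr2 ?sqr_ge0.
Qed.

Lemma sqint0 : sqint (fun=> 0).
Proof.
split; first exact: measurable_cst.
by under eq_integral do rewrite expr0n /=; rewrite integral0.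
Qed.

Lemma sqintDZ f g (c : R) : sqint f -> sqint g -> sqint (fun x => f x + c * g x).
Proof.
move=> sf sg; apply: integrable_mul_sqint.
  apply: measurable_funD; first exact: sf.1.
  by apply: measurable_funM; [exact: measurable_cst|exact: sg.1].
rewrite (_ : (fun x => _) = (fun x => ((f x * f x)%:E +
   ((2 * c)%:E * (f x * g x)%:E + (c * c)%:E * (g x * g x)%:E))%E)).
  apply: integrableD => //; first exact: sqint_integrable_mul.
  by apply: integrableD => //; apply: integrableZl => //; exact: sqint_integrable_mul.
by apply/funext => x; rewrite -!EFinM -!EFinD; congr EFin; ring.
Qed.

Lemma innerC f g : inner f g = inner g f.
Proof. by apply: eq_Rintegral => x _; rewrite mulrC. Qed.

Lemma inner0r f : inner f (fun=> 0) = 0.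
Proof.
by rewrite /inner /Rintegral; under eq_integral do rewrite mulr0; rewrite integral0.
Qed.

Lemma innerDZr f g h (c : R) : sqint f -> sqint g -> sqint h ->
  inner f (fun x => g x + c * h x) = inner f g + c * inner f h.
Proof.
move=> sf sg sh; rewrite /inner -RintegralZl//; last exact: sqint_integrable_mul.
rewrite -RintegralD//.
- by apply: eq_Rintegral => x _; ring.
- exact: sqint_integrable_mul.
- rewrite (_ : EFin \o _ = (fun x => c%:E * (f x * h x)%:E)%E) //.
  by apply: integrableZl => //; exact: sqint_integrable_mul.
Qed.

Lemma inner_ge0 f : 0 <= inner f f.
Proof. by apply: Rintegral_ge0 => x _; rewrite -expr2 sqr_ge0. Qed.

(** The squared norms of [f + g] and [f - g] are nonnegative. *)
Lemma inner_unit_le1 f g : sqint f -> sqint g -> inner f f = 1 -> inner g g = 1 ->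
  `|inner f g| <= 1.
Proof.
move=> sf sg f1 g1.
have H (c : R) : inner (fun x => f x + c * g x) (fun x => f x + c * g x)
    = 1 + 2 * c * inner f g + c * c.
  set F := fun x => _; have sF : sqint F by exact: sqintDZ.
  by rewrite innerDZr// (innerC F f) (innerC F g) !innerDZr// f1 g1 (innerC g f); ring.
have := inner_ge0 (fun x => f x + 1 * g x); have := inner_ge0 (fun x => f x + (-1) * g x).
by rewrite !H ler_norml => ? ?; apply/andP; split; lra.
Qed.

Lemma innerE f : sqint f -> (inner f f)%:E = (\int[mu]_(x in D) ((f x) ^+ 2)%:E)%E.
Proof.
move=> sf; rewrite /inner /Rintegral fineK//; apply: integrable_fin_num => //.
exact: (sqint_integrable_mul sf sf).
Qed.

End SquareIntegrable.

Section GlidingHump.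
Context d (T : measurableType d) (R : realType).
Context (mu : {measure set T -> \bar R}) (D : set T) (mD : measurable D).
Local Notation inner := (inner mu D).
Local Notation sqint := (sqint mu D).

(** The sum of the series [c_k v_k] wherever it converges; the upper limit extends
    it to a total function, measurable when the [v_k] are.  Its value at a point
    depends only on the values of the [v_k] there, so that periodicity of the
    [v_k] is inherited. *)
Definition fun_series (c : nat -> R) (v : nat -> T -> R) : T -> R :=
  fun x => fine (limn_esup (fun n => (\sum_(k < n) c k * v k x)%:E)).

Variable v : nat -> T -> R.
Hypothesis sv : forall n, sqint (v n).
Hypothesis v1 : forall n, inner (v n) (v n) = 1.

Let sgn n (h : T -> R) : R := if 0 <= inner (v n) h then 1 else -1.

(** The gliding hump over a sequence of unit vectors: the [m]-th term has size
    [3^-m], and its sign agrees with that of the pairing of [v m] with the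
    preceding partial sum, so that it cannot be cancelled by that sum. *)
Fixpoint hump (n : nat) : T -> R :=
  if n is m.+1 then fun x => hump m x + (sgn m (hump m) / 3 ^+ m) * v m x
  else fun=> 0.

Definition hump_coef n : R := sgn n (hump n) / 3 ^+ n.

Lemma normr_hump_coef n : `|hump_coef n| = (3 ^+ n)^-1.
Proof.
rewrite /hump_coef normrM [X in _ * X = _]ger0_norm ?invr_ge0 ?exprn_ge0//.
by rewrite /sgn; case: ifP => _; rewrite ?normrN normr1 mul1r.
Qed.

Lemma humpE n x : hump n x = \sum_(k < n) hump_coef k * v k x.
Proof.
by elim: n => [|n IH]; rewrite ?big_ord0// big_ord_recr /= IH.
Qed.

Lemma sqint_hump n : sqint (hump n).
Proof. by elim: n => [|n IH]; [exact: sqint0|exact: sqintDZ]. Qed.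

Lemma inner_hump_succ n : (3 ^+ n)^-1 <= `|inner (v n) (hump n.+1)|.
Proof.
rewrite /= innerDZr//; last exact: sqint_hump.
have p : (0 : R) < (3 ^+ n)^-1 by rewrite invr_gt0 exprn_gt0.
rewrite v1 mulr1 /sgn; case: ifPn => [h|]; last rewrite -ltNge => h.
  by rewrite ger0_norm ?addr_ge0 ?mul1r ?(ltW p)//; lra.
by rewrite ltr0_norm; lra.
Qed.

(** Each [v n] pairs with a term of index [k > n] to at most [3^-k], and these
    bounds add up to half of [3^-n], the size gained at step [n]. *)
Lemma inner_hump n m : (2 * 3 ^+ n)^-1 <= `|inner (v n) (hump (n.+1 + m))|.
Proof.
have step k : `|inner (v n) (hump k.+1) - inner (v n) (hump k)| <= (3 ^+ k)^-1.
  rewrite /= innerDZr//; last exact: sqint_hump.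
  rewrite addrC addKr normrM -/(hump_coef k) normr_hump_coef ler_piMr ?invr_ge0 ?exprn_ge0//.
  exact: inner_unit_le1.
have tail : `|inner (v n) (hump (n.+1 + m)) - inner (v n) (hump n.+1)|
    <= (2 * 3 ^+ n)^-1 - (2 * 3 ^+ (n + m))^-1.
  elim: m => [|m IH]; first by rewrite !addn0 !subrr normr0.
  rewrite !addnS (le_trans (ler_distD (inner (v n) (hump (n.+1 + m))) _ _))//.
  apply: (le_trans (lerD (step (n.+1 + m)%N) IH)); rewrite addSn exprS.
  have p : (0 : R) < 3 ^+ (n + m) by rewrite exprn_gt0.
  rewrite !invfM; lra.
have p : (0 : R) < (2 * 3 ^+ (n + m))^-1 by rewrite invr_gt0 mulr_gt0 ?exprn_gt0.
have := inner_hump_succ n; rewrite distrC in tail.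
have := lerB_dist (inner (v n) (hump n.+1)) (inner (v n) (hump (n.+1 + m))).
rewrite invfM in tail p *; lra.
Qed.

(** The square function [H] has finite integral, hence is finite almost
    everywhere, and by convexity it controls all the partial sums at once. *)
Let Hn n x : R := \sum_(k < n) (v k x ^+ 2) / 3 ^+ k.
Let H x : \bar R := (\sum_(0 <= k <oo) ((v k x ^+ 2) / 3 ^+ k)%:E)%E.

Let t_ge0 k x : 0 <= (v k x ^+ 2) / 3 ^+ k :> R.
Proof. by rewrite mulr_ge0 ?sqr_ge0 ?invr_ge0 ?exprn_ge0. Qed.

Lemma sum_inv3_le n : \sum_(k < n) (3 ^+ k)^-1 <= 3 / 2 :> R.
Proof.
suff -> : \sum_(k < n) (3 ^+ k)^-1 = 3 / 2 - (3 / 2) * (3 ^+ n)^-1 :> R.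
  by rewrite gerBl mulr_ge0 ?invr_ge0 ?exprn_ge0.
elim: n => [|n IH]; first by rewrite big_ord0 expr0 invr1 mulr1 subrr.
have p : (3 : R) ^+ n != 0 by rewrite expf_neq0.
rewrite big_ord_recr /= IH exprS invfM; lra.
Qed.

(** Jensen's inequality for the weights [3^-k], of total mass at most [3/2]. *)
Lemma hump_sqr_le n x : hump n x ^+ 2 <= 3 / 2 * Hn n x.
Proof.
suff /le_trans : hump n x ^+ 2 <= (\sum_(k < n) (3 ^+ k)^-1) * Hn n x.
  by apply; rewrite ler_wpM2r ?sum_inv3_le// sumr_ge0.
elim: n => [|n IH]; first by rewrite /Hn !big_ord0 expr0n mulr0.
rewrite /= -/(hump_coef n) /Hn !big_ord_recr /= -/(Hn n x).
move: IH; set A := \sum_(k < n) _; set w := (3 ^+ n)^-1.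
have w0 : 0 <= w by rewrite invr_ge0 exprn_ge0.
have A0 : 0 <= A by apply: sumr_ge0 => k _; rewrite invr_ge0 exprn_ge0.
have B0 : 0 <= Hn n x by apply: sumr_ge0.
move=> IH; set a := hump n x in IH *; set b := v n x.
(* 4 a^2 b^2 <= 4 A H_n b^2 <= (A b^2 + H_n)^2 *)
have key : `|2 * a * b| <= A * b ^+ 2 + Hn n x.
  rewrite -(ler_pXn2r (ltn0Sn 1)) ?nnegrE//; last first.
    by rewrite addr_ge0// mulr_ge0 ?sqr_ge0.
  rewrite real_normK ?num_real//.
  have : b ^+ 2 * a ^+ 2 <= b ^+ 2 * (A * Hn n x) by rewrite ler_wpM2l ?sqr_ge0.
  have := sqr_ge0 (A * b ^+ 2 - Hn n x); nra.
have ab : hump_coef n * (2 * a * b) <= w * (A * b ^+ 2 + Hn n x).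
  apply: (le_trans (ler_norm _)); rewrite normrM normr_hump_coef -/w.
  by rewrite ler_wpM2l.
have cc : hump_coef n ^+ 2 = w ^+ 2 by rewrite -real_normK ?num_real// normr_hump_coef.
have -> : (a + hump_coef n * b) ^+ 2 =
    a ^+ 2 + hump_coef n * (2 * a * b) + hump_coef n ^+ 2 * b ^+ 2 by ring.
rewrite cc; nra.
Qed.

Lemma HnE n x : (Hn n x)%:E = (\sum_(0 <= k < n) ((v k x ^+ 2) / 3 ^+ k)%:E)%E.
Proof. by rewrite sumEFin big_mkord. Qed.

Lemma Hn_le n x : ((Hn n x)%:E <= H x)%E.
Proof. by rewrite HnE; apply: nneseries_lim_ge => k _; rewrite lee_fin. Qed.

Let mv n : measurable_fun D (v n) := (sv n).1.

Lemma measurable_Hterm k : measurable_fun D (fun x => ((v k x ^+ 2) / 3 ^+ k)%:E).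
Proof.
by apply/measurable_EFinP/measurable_funM; [exact: measurable_funX|exact: measurable_cst].
Qed.

Lemma mH : measurable_fun D H.
Proof. by apply: ge0_emeasurable_sum => k *; [rewrite lee_fin|exact: measurable_Hterm]. Qed.

Lemma H_ge0 x : (0 <= H x)%E.
Proof. by apply: nneseries_ge0 => k _ _; rewrite lee_fin. Qed.

Lemma integral_H : (\int[mu]_(x in D) H x < +oo)%E.
Proof.
rewrite integral_nneseries//; last 2 first.
- by move=> k; exact: measurable_Hterm.
- by move=> k x _; rewrite lee_fin.
apply: (@le_lt_trans _ _ (3 / 2)%:E); last exact: ltry.
apply: lime_le.
  by apply: is_cvg_nneseries => k _ _; apply: integral_ge0 => x _; rewrite lee_fin.
apply: nearW => n; rewrite (eq_bigr (fun k => ((3 ^+ k)^-1)%:E)) => [|k _].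
  by rewrite sumEFin lee_fin big_mkord sum_inv3_le.
under eq_integral do rewrite mulrC EFinM.
rewrite ge0_integralZl//.
- by rewrite -innerE// v1 mule1.
- by apply/measurable_EFinP; exact: measurable_funX.
- by move=> x _; rewrite lee_fin sqr_ge0.
Qed.

Lemma integrable_H : mu.-integrable D H.
Proof.
apply/integrableP; split; first exact: mH.
by under eq_integral do rewrite gee0_abs ?H_ge0//; exact: integral_H.
Qed.

(** Since [|a| <= 1 + a^2], finiteness of [H] at a point gives absolute
    convergence there. *)
Lemma is_cvg_hump x : (H x < +oo)%E -> cvgn (fun n => hump n x).
Proof.
move=> Hx.
have Hf : H x \is a fin_num by rewrite ge0_fin_numE// H_ge0.
have -> : (fun n => hump n x) = series (fun k => hump_coef k * v k x).
  by apply/funext => n; rewrite humpE seriesEord.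
apply: normed_cvg; apply: nondecreasing_is_cvgn.
  by apply: nondecreasing_series => k _ _; exact: normr_ge0.
exists (3 / 2 + fine (H x)) => _ [n _ <-].
change (series (fun k => `|hump_coef k * v k x|) n <= 3 / 2 + fine (H x)).
rewrite seriesEord /=.
have : \sum_(k < n) (3 ^+ k)^-1 + Hn n x <= 3 / 2 + fine (H x).
  by rewrite lerD ?sum_inv3_le// -lee_fin fineK// Hn_le.
apply: le_trans; rewrite /Hn -big_split /=; apply: ler_sum => k _.
rewrite normrM normr_hump_coef mulrC -[X in X + _]mul1r -mulrDl.
rewrite ler_wpM2r ?invr_ge0 ?exprn_ge0// -[_ ^+ 2]real_normK ?num_real//.
by have := sqr_ge0 (`|v k x| - 1); have := normr_ge0 (v k x); nra.
Qed.

Let g := fun_series hump_coef v.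

Lemma cvg_hump x : (H x < +oo)%E -> hump n x @[n --> \oo] --> g x.
Proof.
move=> Hx; have ch := is_cvg_hump Hx.
suff -> : g x = limn (fun n => hump n x) by [].
rewrite /g /fun_series.
have -> : (fun n => (\sum_(k < n) hump_coef k * v k x)%:E) = EFin \o (fun n => hump n x).
  by apply/funext => n /=; rewrite humpE.
have /cvg_limn_einf_sup[_ ->] // : (EFin \o (fun n => hump n x)) @ \oo -->
    (limn (fun n => hump n x))%:E.
by apply: cvg_EFin => //; exact: nearW.
Qed.

Lemma measurable_fun_series c (E : set T) : (forall k, measurable_fun E (v k)) ->
  measurable_fun E (fun_series c v).
Proof.
move=> mE; apply: (measurableT_comp (fine_measurable measurableT)).
apply: measurable_fun_limn_esup => n; apply/measurable_EFinP.
by apply: measurable_sum => k; apply: measurable_funM.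
Qed.

Lemma sqint_fun_series : sqint g.
Proof.
split; first exact: measurable_fun_series.
apply: (@le_lt_trans _ _ (\int[mu]_(x in D) ((3 / 2)%:E * H x))%E).
  apply: ge0_le_integral => //.
  - by move=> x _; rewrite lee_fin sqr_ge0.
  - by apply/measurable_EFinP; apply: measurable_funX; exact: measurable_fun_series.
  - by apply: emeasurable_funM; [exact: measurable_cst|exact: mH].
  move=> x _; have [Hx|] := ltP (H x) +oo%E; last first.
    by rewrite leye_eq => /eqP ->; rewrite gt0_muley ?lte_fin ?leey//.
  have Hf : H x \is a fin_num by rewrite ge0_fin_numE// H_ge0.
  rewrite -(fineK Hf) -EFinM lee_fin.
  have cg := cvg_hump Hx.
  have cg2 : (hump n x ^+ 2) @[n --> \oo] --> g x ^+ 2 by exact: cvgM.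
  rewrite -(cvg_lim (@Rhausdorff R) cg2); apply: limr_le.
    by apply/cvg_ex; exists (g x ^+ 2).
  apply: nearW => n; apply: (le_trans (hump_sqr_le n x)).
  by rewrite ler_wpM2l// -lee_fin fineK// Hn_le.
rewrite ge0_integralZl//; last 2 first.
- exact: mH.
- by move=> x _; exact: H_ge0.
by rewrite lte_mul_pinfty// ?fin_numE// integral_H.
Qed.

(** The lower bound on the partial sums passes to the limit by dominated
    convergence, [v n ^ 2 + 3/2 H] being the dominating function. *)
Lemma inner_fun_series n : (2 * 3 ^+ n)^-1 <= `|inner (v n) g|.
Proof.
have Sg := sqint_integrable_mul mD (sv n) sqint_fun_series.
have pw : {ae mu, forall x, D x ->
    (fun m => (v n x * hump m x)%:E) @ \oo --> (v n x * g x)%:E}.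
  apply: filterS (integrable_ae mD integrable_H) => x fx Dx.
  apply: cvg_EFin; first exact: nearW.
  apply: cvgM; first exact: cvg_cst.
  by apply: cvg_hump; rewrite -ge0_fin_numE ?H_ge0 ?fx.
have dom : {ae mu, forall x m, D x ->
    (`|(v n x * hump m x)%:E| <= (v n x * v n x)%:E + (3 / 2)%:E * H x)%E}.
  apply: aeW => x m _ /=.
  have [Hx|] := ltP (H x) +oo%E; last first.
    by rewrite leye_eq => /eqP ->; rewrite gt0_muley ?lte_fin// addey ?leey.
  have Hf : H x \is a fin_num by rewrite ge0_fin_numE// H_ge0.
  rewrite -(fineK Hf) -EFinM -EFinD lee_fin normrM.
  have h2 : hump m x ^+ 2 <= 3 / 2 * fine (H x).
    apply: (le_trans (hump_sqr_le m x)).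
    by rewrite ler_wpM2l// -lee_fin fineK// Hn_le.
  apply: le_trans (lerD (lexx _) h2).
  rewrite -expr2 -[v n x ^+ 2]real_normK ?num_real//.
  rewrite -[hump m x ^+ 2]real_normK ?num_real//.
  have := sqr_ge0 (`|v n x| - `|hump m x|).
  have := normr_ge0 (v n x); have := normr_ge0 (hump m x); nra.
have Idom : mu.-integrable D (fun x => (v n x * v n x)%:E + (3 / 2)%:E * H x)%E.
  apply: integrableD => //; first exact: (sqint_integrable_mul mD (sv n) (sv n)).
  by apply: integrableZl => //; exact: integrable_H.
have [_ _ cve] :=
  lebesgue_integral_dominated_convergence.dominated_convergence mD
    (fun m => measurable_int mu (sqint_integrable_mul mD (sv n) (sqint_hump m)))
    (measurable_int mu Sg) pw Idom dom.
have cv : inner (v n) (hump m) @[m --> \oo] --> inner (v n) g.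
  by apply: fine_cvg; rewrite /inner /Rintegral fineK//; exact: integrable_fin_num.
have {}cv : (fun m => `|inner (v n) (hump m)|) @ \oo --> `|inner (v n) g|.
  exact: cvg_norm.
rewrite -(cvg_lim (@Rhausdorff R) cv); apply: limr_ge.
  by apply/cvg_ex; exists `|inner (v n) g|.
exists n.+1 => // m /= nm; rewrite -(subnKC nm).
exact: inner_hump.
Qed.

End GlidingHump.

Section UniformBoundedness.
Context d (T : measurableType d) (R : realType).
Context (mu : {measure set T -> \bar R}) (D : set T) (mD : measurable D).

(** Were the family unbounded, it would contain members of norm at least
    [2 (n + 1) 3^n] for every [n]; the gliding hump over their normalisations
    pairs with the [n]-th member to at least [n + 1].  Only series of members of the
    family serve as test functions, so that the principle applies inside a
    class of functions, such as the periodic ones, closed under such series. *)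
Lemma L2_uniform_boundedness (I : Type) (u : I -> T -> R) :
  (forall i, sqint mu D (u i)) ->
  (forall (c : nat -> R) (i : nat -> I),
     let g := fun_series c (fun n => u (i n)) in
     sqint mu D g -> exists M, forall j, `|inner mu D (u j) g| <= M) ->
  exists M, forall i, inner mu D (u i) (u i) <= M.
Proof.
move=> su bnd; apply: contrapT => unb.
have big n : exists i, (2 * n.+1%:R * 3 ^+ n) ^+ 2 <= inner mu D (u i) (u i).
  apply: contrapT => H; apply: unb; exists ((2 * n.+1%:R * 3 ^+ n) ^+ 2) => i.
  by rewrite leNgt; apply/negP => /ltW h; apply: H; exists i.
have /choice[i iP] := big.
pose r n := Num.sqrt (inner mu D (u (i n)) (u (i n))).
have r_ge n : 2 * n.+1%:R * 3 ^+ n <= r n.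
  have p : 0 <= 2 * n.+1%:R * 3 ^+ n :> R by rewrite !mulr_ge0 ?exprn_ge0.
  by rewrite -(ger0_norm p) -sqrtr_sqr ler_sqrt ?inner_ge0.
have r_gt0 n : 0 < r n.
  by apply: lt_le_trans (r_ge n); rewrite !mulr_gt0 ?exprn_gt0.
pose v n x := (r n)^-1 * u (i n) x.
have vE n : v n = (fun x => 0 + (r n)^-1 * u (i n) x).
  by apply/funext => x; rewrite add0r.
have sv n : sqint mu D (v n) by rewrite vE; apply: sqintDZ => //; exact: sqint0.
have ipv n h : sqint mu D h -> inner mu D h (v n) = (r n)^-1 * inner mu D h (u (i n)).
  by move=> sh; rewrite vE innerDZr ?inner0r ?add0r//; exact: sqint0.
have v1 n : inner mu D (v n) (v n) = 1.
  rewrite ipv// innerC ipv// mulrA -invfM -expr2 sqr_sqrtr ?inner_ge0// mulVf//.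
  by rewrite gt_eqF// -sqrtr_gt0 r_gt0.
pose c n := hump_coef mu D v n * (r n)^-1.
have gE : fun_series (hump_coef mu D v) v = fun_series c (fun n => u (i n)).
  apply/funext => x; rewrite /fun_series; do 2 congr (_ _); apply/funext => n.
  by congr EFin; apply: eq_bigr => k _; rewrite /c /v mulrA.
have sg := sqint_fun_series mD sv v1.
have := bnd c i; rewrite /= -gE => /(_ sg)[M MP].
have M0 : 0 <= M by apply: le_trans (MP (i 0%N)).
have [n Mn] : exists n, M < n.+1%:R.
  by exists (Num.truncn M); exact: truncnS_gt.
have := inner_fun_series mD sv v1 n; rewrite innerC ipv// normrM gtr0_norm ?invr_gt0//.
rewrite innerC => h; have := MP (i n); apply/negP; rewrite -ltNge.
apply: (lt_le_trans Mn).
have p : (0 : R) < 2 * 3 ^+ n by rewrite mulr_gt0 ?exprn_gt0.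
move: h; rewrite ler_pdivlMl// => h; apply: le_trans h.
rewrite ler_pdivlMr//; apply: le_trans (r_ge n); rewrite le_eqVlt; apply/orP; left.
by apply/eqP; ring.
Qed.

End UniformBoundedness.

(** * Integration over the periodic cell *)

Section TorusIntegral.
Context {R : realType}.
Implicit Types f g h : R * R -> R.

Lemma measurable_Omega :
  measurable (Omega : set (plane R)).
Proof. by apply: measurableX; exact: measurable_itv. Qed.

Lemma mu2_Omega : mu2 (Omega : set (R * R)) = ((2 * pi) ^+ 2)%:E.
Proof.
have p : (0 : R) < 2 * pi by rewrite mulr_gt0 ?pi_gt0.
have L : lebesgue_measure (`[0, 2 * pi] : set R) = (2 * pi)%:E.
  by rewrite lebesgue_measure_itv /= lte_fin p -EFinB subr0.
pose I := `[0, 2 * pi]%classic : set R.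
transitivity (lebesgue_measure I * lebesgue_measure I)%E.
  by apply: product_measure1E; exact: measurable_itv.
by rewrite !L -EFinM -expr2.
Qed.

Definition mfun2 f :=
  measurable_fun [set: plane R] f.

Definition bounded2 f := exists M, forall x, Omega x -> `|f x| <= M.

Lemma mfun2D (f : R * R -> R) : mfun2 f ->
  measurable_fun (Omega : set (plane R)) f.
Proof. by move=> mf; apply: measurable_funTS. Qed.

Lemma bounded2_integrable f : mfun2 f -> bounded2 f ->
  mu2.-integrable (Omega : set (plane R)) (EFin \o f).
Proof.
move=> mf [M MP]; apply: measurable_bounded_integrable.
- exact: measurable_Omega.
- by rewrite mu2_Omega ltry.
- exact: mfun2D.
- exists M; split; first exact: num_real.
  by move=> N MN x Ox /=; apply: le_trans (MP x Ox) (ltW MN).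
Qed.

Lemma L2fun_sqint f : L2fun f -> sqint mu2 (Omega : set (plane R)) f.
Proof. by move=> [_ mf fi]; split => //; exact: mfun2D. Qed.

Lemma continuous_bounded2 f : continuous f -> bounded2 f.
Proof.
move=> cf.
have cO : compact (Omega : set (R * R)) by apply: compact_setX; exact: segment_compact.
have /compact_bounded[M [_ MP]] : compact (f @` Omega).
  by apply: continuous_compact => //; exact: continuous_subspaceT.
exists (M + 1) => x Ox; apply: (MP (M + 1)); first by rewrite ltrDl.
by exists x.
Qed.

Lemma mfun2_phase l : mfun2 (phase l).
Proof.
by apply: measurable_funD; apply: measurable_funM.
Qed.

Lemma mfun2_cos l : mfun2 (fun x => cos (phase l x)).
Proof.
apply: (measurableT_comp (f := @cos R)); last exact: mfun2_phase.
by apply: continuous_measurable_fun; exact: continuous_cos.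
Qed.

Lemma mfun2_sin l : mfun2 (fun x => sin (phase l x)).
Proof.
apply: (measurableT_comp (f := @sin R)); last exact: mfun2_phase.
by apply: continuous_measurable_fun; exact: continuous_sin.
Qed.

Lemma normr_cos_le1 (a : R) : `|cos a| <= 1.
Proof. by rewrite ler_norml cos_geN1 cos_le1. Qed.

Lemma normr_sin_le1 (a : R) : `|sin a| <= 1.
Proof. by rewrite ler_norml sin_geN1 sin_le1. Qed.

(** Fubini's theorem; the next lemma is the same for the other variable. *)
Lemma intOmega_eq0_fst f :
  mu2.-integrable (Omega : set (plane R)) (EFin \o f) ->
  (forall y, (\int[lebesgue_measure]_(x in `[0%R, (2 * pi)%R]) (f (x, y))%:E = 0)%E) ->
  intOmega f = 0.
Proof.
move=> fi f0; have fi' := fi; rewrite (integrable_mkcond _ measurable_Omega) in fi'.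
suff E : (\int[mu2]_z ((EFin \o f) \_ (Omega : set (plane R))) z = 0)%E.
  by rewrite /intOmega /Rintegral integral_mkcond; move: E => /= ->.
rewrite -(@integral21_prod_meas1 _ _ _ _ R lebesgue_measure lebesgue_measure _ fi').
rewrite (eq_integral (cst 0%E)) ?integral0// => y _.
rewrite /fubini_G.
have [Iy|nIy] := pselect (`[0, 2 * pi]%classic y).
  rewrite -(f0 y) [RHS]integral_mkcond; apply: eq_integral => x _.
  rewrite /patch; congr (if _ then _ else _).
  by apply/idP/idP; rewrite !inE; [case|move=> ?; split].
rewrite (eq_integral (cst 0%E)) ?integral0// => x _.
by rewrite /patch; case: ifPn => //; rewrite inE => -[].
Qed.

Lemma intOmega_eq0_snd f :
  mu2.-integrable (Omega : set (plane R)) (EFin \o f) ->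
  (forall x, (\int[lebesgue_measure]_(y in `[0%R, (2 * pi)%R]) (f (x, y))%:E = 0)%E) ->
  intOmega f = 0.
Proof.
move=> fi f0; have fi' := fi; rewrite (integrable_mkcond _ measurable_Omega) in fi'.
suff E : (\int[mu2]_z ((EFin \o f) \_ (Omega : set (plane R))) z = 0)%E.
  by rewrite /intOmega /Rintegral integral_mkcond; move: E => /= ->.
rewrite -(@integral12_prod_meas1 _ _ _ _ R lebesgue_measure lebesgue_measure _ fi').
rewrite (eq_integral (cst 0%E)) ?integral0// => x _.
rewrite /fubini_F.
have [Ix|nIx] := pselect (`[0, 2 * pi]%classic x).
  rewrite -(f0 x) [RHS]integral_mkcond; apply: eq_integral => y _.
  rewrite /patch; congr (if _ then _ else _).
  by apply/idP/idP; rewrite !inE; [case|move=> ?; split].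
rewrite (eq_integral (cst 0%E)) ?integral0// => y _.
by rewrite /patch; case: ifPn => //; rewrite inE => -[].
Qed.

End TorusIntegral.

(** * Directional derivatives integrate to zero *)

Section Parts.
Context {R : realType}.
Implicit Types f g h : R * R -> R.

(** Derivatives along [v] become derivatives of one-variable functions, to which
    the one-variable chain rule applies. *)
Lemma is_derive_line f (x v : R * R) (df : R) :
  is_derive x v f df <-> is_derive (0 : R) (1 : R) (fun s : R => f (s *: v + x)) df.
Proof.
have E : (fun s : R => s^-1 *: ((f \o shift x) (s *: v) - f x)) =
  (fun s : R => s^-1 *: (((fun s : R => f (s *: v + x)) \o shift (0 : R)) (s *: (1 : R)) -
                 f ((0 : R) *: v + x))).
  apply/funext => s /=; rewrite scale0r add0r addr0.
  by rewrite (_ : s *: (1 : R) = s)// /GRing.scale /= mulr1.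
by split=> -[d1 d2]; split; move: d1 d2; rewrite /derivable /derive E.
Qed.

Lemma is_derive_fst f (a b df : R) : is_derive (a, b) (evec ord0) f df ->
  is_derive (a : R) (1 : R) (fun s : R => f (s, b)) df.
Proof.
have E : (fun s : R => s^-1 *: ((f \o shift (a, b)) (s *: evec ord0) - f (a, b))) =
  (fun s : R => s^-1 *: (((fun s : R => f (s, b)) \o shift (a : R)) (s *: (1 : R)) - f (a, b))).
  apply/funext => s; rewrite /evec eqxx; congr (_ *: (f _ - _)).
  by rewrite /= /shift /=; congr pair; rewrite /= /GRing.scale /= mulr0 add0r.
by case=> d1 d2; split; move: d1 d2; rewrite /derivable /derive E.
Qed.

Lemma is_derive_snd f (a b df : R) : is_derive (a, b) (evec ord_max) f df ->
  is_derive (b : R) (1 : R) (fun s : R => f (a, s)) df.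
Proof.
have E : (fun s : R => s^-1 *: ((f \o shift (a, b)) (s *: evec ord_max) - f (a, b))) =
  (fun s : R => s^-1 *: (((fun s : R => f (a, s)) \o shift (b : R)) (s *: (1 : R)) - f (a, b))).
  apply/funext => s; rewrite /evec /=; congr (_ *: (f _ - _)).
  by rewrite /= /shift /=; congr pair; rewrite /= /GRing.scale /= mulr0 add0r.
by case=> d1 d2; split; move: d1 d2; rewrite /derivable /derive E.
Qed.

Lemma mfun2_shift h (v : R * R) : mfun2 h -> mfun2 (fun x => h (v + x)).
Proof.
move=> mh; apply: (measurableT_comp (f := (h : (plane R) -> R))) => //.
by apply/measurable_fun_pairP; split; apply: measurable_funD.
Qed.

(** A derivative is the pointwise limit of the difference quotients with steps
    [1 / (n + 1)], each of which is measurable. *)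
Lemma mfun2_partial i h : mfun2 h -> (forall x, derivable h x (evec i)) ->
  mfun2 (partial i h).
Proof.
move=> mh dh.
apply: (@measurable_fun_cvg _ (plane R) R setT
  (fun n x => (harmonic n)^-1 * (h (harmonic n *: evec i + x) - h x))).
  move=> n; apply: measurable_funM => //; apply: measurable_funB => //.
  exact: mfun2_shift.
move=> x _.
have harm : harmonic @ \oo --> (0 : R)^'.
  move=> A A0; have := @cvg_harmonic R _ A0.
  rewrite /nbhs /=; apply: (@filterS _ \oo) => n /=; apply.
  by apply: lt0r_neq0; exact: harmonic_gt0.
have := dh x => /cvg_ex[l hl].
have -> : partial i h x = l by exact: cvg_lim hl.
exact: cvg_comp harm hl.
Qed.

Lemma integral_derivative_periodic (F f : R -> R) :
  (forall x, is_derive (x : R) (1 : R) F (f x)) -> continuous f ->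
  F (2 * pi) = F 0 ->
  (\int[lebesgue_measure]_(x in `[0%R, (2 * pi)%R]) (f x)%:E = 0)%E.
Proof.
move=> dF cf per.
have p : (0 : R) < 2 * pi by rewrite mulr_gt0 ?pi_gt0.
have cF : continuous F.
  by move=> x; apply/differentiable_continuous/derivable1_diffP; have [] := dF x.
rewrite (@continuous_FTC2 _ f F)//.
- by rewrite per subee.
- exact: continuous_subspaceT.
- split; first by move=> x _; have [] := dF x.
  + exact/cvg_at_right_filter/cF.
  + exact/cvg_at_left_filter/cF.
- by move=> x _; rewrite derive1E; have [_ ->] := dF x.
Qed.

(** The fundamental theorem of calculus on each slice in the direction [i], where
    the boundary terms cancel by periodicity. *)
Lemma intOmega_partial i h : periodic2 h -> mfun2 h ->
  (forall x, derivable h x (evec i)) -> continuous (partial i h) ->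
  intOmega (partial i h) = 0.
Proof.
move=> ph mh dh ch.
have fi : mu2.-integrable (Omega : set (plane R)) (EFin \o partial i h).
  by apply: bounded2_integrable; [exact: mfun2_partial|exact: continuous_bounded2].
have [i0|i1] : i = ord0 \/ i = ord_max.
  case: i {dh ch fi} => -[|[|//]] ?; [left|right]; exact: val_inj.
- subst i; apply: intOmega_eq0_fst => // y.
  apply: (@integral_derivative_periodic (fun x => h (x, y))).
  + by move=> x; apply: is_derive_fst; apply: DeriveDef.
  + move=> x; apply: (@continuous_comp _ _ _ (fun x => (x, y)) (partial ord0 h)); last exact: ch.
    have cp : (fun s : R => (s, y)) @ x --> (x, y).
      by apply: (@cvg_pair _ _ _ _ (nbhs x) (nbhs y)); [exact: cvg_id|exact: cvg_cst].
    exact: cp.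
  + by have [] := ph (0, y); rewrite /= add0r.
- subst i; apply: intOmega_eq0_snd => // x.
  apply: (@integral_derivative_periodic (fun y => h (x, y))).
  + by move=> y; apply: is_derive_snd; apply: DeriveDef.
  + move=> y; apply: (@continuous_comp _ _ _ (fun y => (x, y)) (partial ord_max h)); last exact: ch.
    have cp : (fun s : R => (x, s)) @ y --> (x, y).
      by apply: (@cvg_pair _ _ _ _ (nbhs x) (nbhs y)); [exact: cvg_cst|exact: cvg_id].
    exact: cp.
  + by have [_] := ph (x, 0); rewrite /= add0r.
Qed.

End Parts.

(** * Trigonometric modes and integration by parts *)

Section Trig.
Context {R : realType}.
Implicit Types f g h : R * R -> R.

Definition freq (l : int * int) (i : 'I_2) : R :=
  if i == ord0 then l.1%:~R else l.2%:~R.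

Lemma phase_line (l : int * int) i (s : R) (x : R * R) :
  phase l (s *: evec i + x) = phase l x + s * freq l i.
Proof.
rewrite /phase /evec /freq; case: ifP => _ /=; rewrite /GRing.scale /=; ring.
Qed.

Lemma is_derive_phase_comp (F F' : R -> R) l i x :
  (forall a, is_derive (a : R) (1 : R) F (F' a)) ->
  is_derive (x : R * R) (evec i) (fun x => F (phase l x)) (freq l i * F' (phase l x)).
Proof.
move=> dF; apply/is_derive_line.
rewrite (_ : (fun s : R => _) = F \o (fun s : R => phase l x + s * freq l i)); last first.
  by apply/funext => s; rewrite phase_line.
rewrite mulrC; apply: is_derive1_comp; first by rewrite mul0r addr0.
rewrite -[X in is_derive _ _ _ X]add0r; apply: is_deriveD.
rewrite (_ : (fun s : R => _) = (fun s => freq l i *: (s : R))); last first.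
  by apply/funext => s; rewrite mulrC.
by rewrite -[X in is_derive _ _ _ X]mulr1; exact: is_deriveZ.
Qed.

Lemma is_derive_cos_phase l i x :
  is_derive (x : R * R) (evec i) (fun x => cos (phase l x)) (freq l i * - sin (phase l x)).
Proof. by apply: is_derive_phase_comp => a; exact: is_derive_cos. Qed.

Lemma is_derive_sin_phase l i x :
  is_derive (x : R * R) (evec i) (fun x => sin (phase l x)) (freq l i * cos (phase l x)).
Proof. by apply: is_derive_phase_comp => a; exact: is_derive_sin. Qed.

Lemma continuous_phase l : continuous (phase l : R * R -> R).
Proof.
by move=> x; apply: cvgD; (apply: cvgM; first exact: cvg_cst);
  [exact: cvg_fst|exact: cvg_snd].
Qed.

Lemma continuous_cos_phase l : continuous (fun x : R * R => cos (phase l x)).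
Proof.
by move=> x; apply: (continuous_comp (@continuous_phase l x)); exact: continuous_cos.
Qed.

Lemma continuous_sin_phase l : continuous (fun x : R * R => sin (phase l x)).
Proof.
by move=> x; apply: (continuous_comp (@continuous_phase l x)); exact: continuous_sin.
Qed.

(** Extends the natural multiples of a period to the integer ones. *)
Lemma periodic_int (F : R -> R) (T : R) : periodic F T ->
  forall (m : int) a, F (a + m%:~R * T) = F a.
Proof.
move=> pF [n|n] a; first by rewrite -pmulrn mulr_natl periodicn.
rewrite NegzE mulrNz mulNr -pmulrn mulr_natl.
by rewrite -[in RHS](subrK (T *+ n.+1) a) periodicn.
Qed.

Lemma periodic2_phase_comp (F : R -> R) l : periodic F (pi *+ 2) ->
  periodic2 (fun x => F (phase l x)).
Proof.
move=> pF x; rewrite /phase /=; split.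
  rewrite -[RHS](periodic_int pF l.1); congr F; rewrite -mulr_natl; ring.
rewrite -[RHS](periodic_int pF l.2); congr F; rewrite -mulr_natl; ring.
Qed.

Lemma periodic2_cos l : periodic2 (fun x : R * R => cos (phase l x)).
Proof. by apply: periodic2_phase_comp; exact: cosD2pi. Qed.

Lemma periodic2_sin l : periodic2 (fun x : R * R => sin (phase l x)).
Proof. by apply: periodic2_phase_comp; exact: sinD2pi. Qed.

Lemma periodic2M f g : periodic2 f -> periodic2 g -> periodic2 (fun x => f x * g x).
Proof. by move=> pf pg x; have [-> ->] := pf x; have [-> ->] := pg x. Qed.

Definition intble f := mu2.-integrable (Omega : set (plane R)) (EFin \o f).

Lemma intbleD f g : intble f -> intble g -> intble (fun x => f x + g x).
Proof.
by move=> If Ig; have := integrableD measurable_Omega If Ig.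
Qed.

Lemma intbleZ c f : intble f -> intble (fun x => c * f x).
Proof. by move=> If; have := integrableZl measurable_Omega c If. Qed.

Lemma intble_sum (I : Type) (r : seq I) (F : I -> R * R -> R) :
  (forall i, intble (F i)) -> intble (fun x => \sum_(i <- r) F i x).
Proof.
move=> IF; rewrite /intble.
rewrite (_ : EFin \o _ = fun x => (\sum_(i <- r) (F i x)%:E)%E).
  by apply: (integrable_sum measurable_Omega) => i _; exact: IF.
by apply/funext => x /=; rewrite sumEFin.
Qed.

Lemma intOmegaD f g : intble f -> intble g ->
  intOmega (fun x => f x + g x) = intOmega f + intOmega g.
Proof. by move=> If Ig; rewrite /intOmega RintegralD//; exact: measurable_Omega. Qed.

Lemma intOmegaZ c f : intble f -> intOmega (fun x => c * f x) = c * intOmega f.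
Proof. by move=> If; rewrite /intOmega RintegralZl//; exact: measurable_Omega. Qed.

Lemma intOmega0 : intOmega (fun _ : R * R => 0) = 0.
Proof. by rewrite /intOmega /Rintegral integral0. Qed.

Lemma intOmega_sum (I : Type) (r : seq I) (F : I -> R * R -> R) :
  (forall i, intble (F i)) ->
  intOmega (fun x => \sum_(i <- r) F i x) = \sum_(i <- r) intOmega (F i).
Proof.
move=> IF; elim: r => [|i r IH].
  rewrite big_nil -[RHS]intOmega0; congr intOmega.
  by apply/funext => x; rewrite big_nil.
rewrite big_cons -IH -intOmegaD//; last exact: intble_sum.
by congr intOmega; apply/funext => x; rewrite big_cons.
Qed.

Lemma intble_continuous f : mfun2 f -> continuous f -> intble f.
Proof. by move=> mf cf; apply: bounded2_integrable => //; exact: continuous_bounded2. Qed.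

Lemma intble_cos l : intble (fun x => cos (phase l x)).
Proof. by apply: intble_continuous; [exact: mfun2_cos|exact: continuous_cos_phase]. Qed.

Lemma intble_sin l : intble (fun x => sin (phase l x)).
Proof. by apply: intble_continuous; [exact: mfun2_sin|exact: continuous_sin_phase]. Qed.

Lemma freq_neq0 l : l != 0 -> exists i, freq l i != 0.
Proof.
case: l => a b; have [->|a0] := eqVneq a 0 => l0.
  exists ord_max; rewrite /freq /= intr_eq0.
  by apply: contra l0 => /eqP ->.
by exists ord0; rewrite /freq /= intr_eq0.
Qed.

Lemma partial_val i f g : (forall x, is_derive (x : R * R) (evec i) f (g x)) ->
  (forall x, derivable f x (evec i)) /\ partial i f = g.
Proof.
by move=> d; split=> [x|]; [have [] := d x|apply/funext => x; have [_] := d x].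
Qed.

(** In a direction where the frequency does not vanish, the mode is the
    derivative of a periodic function, up to a nonzero factor. *)
Lemma intOmega_cos l : l != 0 -> intOmega (fun x : R * R => cos (phase l x)) = 0.
Proof.
move=> /freq_neq0[i fi].
have [dS pS] := partial_val (fun x => is_derive_sin_phase l i x).
have := intOmega_partial (@periodic2_sin l) (mfun2_sin l) dS.
rewrite pS intOmegaZ; last exact: intble_cos.
move=> H; apply: (mulfI fi); rewrite mulr0 H// => x.
by apply: cvgM; [exact: cvg_cst|exact: continuous_cos_phase].
Qed.

Lemma intOmega_sin l : intOmega (fun x : R * R => sin (phase l x)) = 0.
Proof.
have [->|/freq_neq0[i fi]] := eqVneq l 0.
  rewrite -[RHS]intOmega0; congr intOmega; apply/funext => x.
  by rewrite /phase /= !mul0r addr0 sin0.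
have [dS pS] := partial_val (fun x => is_derive_cos_phase l i x).
have := intOmega_partial (@periodic2_cos l) (mfun2_cos l) dS.
rewrite pS (_ : (fun x => _) = (fun x => - freq l i * sin (phase l x))); last first.
  by apply/funext => x; rewrite mulrN mulNr.
rewrite intOmegaZ; last exact: intble_sin.
rewrite -oppr_eq0 in fi.
move=> H; apply: (mulfI fi); rewrite mulr0 H// => x.
by apply: cvgM; [exact: cvg_cst|exact: continuous_sin_phase].
Qed.

Lemma intOmega_cos0 : intOmega (fun x : R * R => cos (phase 0 x)) = (2 * pi) ^+ 2.
Proof.
rewrite (_ : (fun x => _) = cst 1); last first.
  by apply/funext => x; rewrite /phase /= !mul0r addr0 cos0.
rewrite /intOmega Rintegral_cst; last exact: measurable_Omega.
by rewrite mul1r mu2_Omega.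
Qed.

(** The derivative of [f * cos (phase l)] has integral zero. *)
Lemma intOmega_partial_cos f l i : periodic2 f -> mfun2 f -> continuous f ->
  (forall x, derivable f x (evec i)) -> continuous (partial i f) ->
  intOmega (fun x => partial i f x * cos (phase l x))
  = freq l i * intOmega (fun x => f x * sin (phase l x)).
Proof.
move=> pf mf cf df cpf.
have D x : is_derive (x : R * R) (evec i) (fun x => f x * cos (phase l x))
   (partial i f x * cos (phase l x) + - freq l i * (f x * sin (phase l x))).
  have d1 : is_derive (x : R * R) (evec i) f (partial i f x) by apply: DeriveDef.
  have := is_deriveM d1 (is_derive_cos_phase l i x).
  rewrite (_ : _ *: _ + _ *: _ =
    partial i f x * cos (phase l x) + - freq l i * (f x * sin (phase l x)))//.
  rewrite /GRing.scale /=; ring.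
have [dD pD] := partial_val D.
have I1 : intble (fun x => partial i f x * cos (phase l x)).
  apply: intble_continuous.
    by apply: measurable_funM; [exact: mfun2_partial|exact: mfun2_cos].
  by move=> x; apply: cvgM; [exact: cpf|exact: continuous_cos_phase].
have I2 : intble (fun x => f x * sin (phase l x)).
  apply: intble_continuous.
    by apply: measurable_funM; [exact: mf|exact: mfun2_sin].
  by move=> x; apply: cvgM; [exact: cf|exact: continuous_sin_phase].
have := intOmega_partial (periodic2M pf (@periodic2_cos l)) (measurable_funM mf (mfun2_cos l)) dD.
rewrite pD intOmegaD//; last exact: intbleZ.
rewrite intOmegaZ// => H; apply/eqP; rewrite -subr_eq0 -mulNr H// => x.
apply: cvgD; first by apply: cvgM; [exact: cpf|exact: continuous_cos_phase].
apply: cvgM; first exact: cvg_cst.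
by apply: cvgM; [exact: cf|exact: continuous_sin_phase].
Qed.

Lemma intOmega_partial_sin f l i : periodic2 f -> mfun2 f -> continuous f ->
  (forall x, derivable f x (evec i)) -> continuous (partial i f) ->
  intOmega (fun x => partial i f x * sin (phase l x))
  = - freq l i * intOmega (fun x => f x * cos (phase l x)).
Proof.
move=> pf mf cf df cpf.
have D x : is_derive (x : R * R) (evec i) (fun x => f x * sin (phase l x))
   (partial i f x * sin (phase l x) + freq l i * (f x * cos (phase l x))).
  have d1 : is_derive (x : R * R) (evec i) f (partial i f x) by apply: DeriveDef.
  have := is_deriveM d1 (is_derive_sin_phase l i x).
  rewrite (_ : _ *: _ + _ *: _ =
    partial i f x * sin (phase l x) + freq l i * (f x * cos (phase l x)))//.
  rewrite /GRing.scale /=; ring.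
have [dD pD] := partial_val D.
have I1 : intble (fun x => partial i f x * sin (phase l x)).
  apply: intble_continuous.
    by apply: measurable_funM; [exact: mfun2_partial|exact: mfun2_sin].
  by move=> x; apply: cvgM; [exact: cpf|exact: continuous_sin_phase].
have I2 : intble (fun x => f x * cos (phase l x)).
  apply: intble_continuous.
    by apply: measurable_funM; [exact: mf|exact: mfun2_cos].
  by move=> x; apply: cvgM; [exact: cf|exact: continuous_cos_phase].
have := intOmega_partial (periodic2M pf (@periodic2_sin l)) (measurable_funM mf (mfun2_sin l)) dD.
rewrite pD intOmegaD//; last exact: intbleZ.
rewrite intOmegaZ// => H; apply/eqP; rewrite -subr_eq0 -mulNr opprK H// => x.
apply: cvgD; first by apply: cvgM; [exact: cpf|exact: continuous_sin_phase].
apply: cvgM; first exact: cvg_cst.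
by apply: cvgM; [exact: cf|exact: continuous_cos_phase].
Qed.

End Trig.

(** * Fourier coefficients and Bessel's inequality *)

Section Fourier.
Local Open Scope complex_scope.
Context {R : realType}.
Implicit Types f g h : R * R -> R.

Definition ccoef f l := intOmega (fun x => f x * cos (phase l x)).
Definition scoef f l := intOmega (fun x => f x * sin (phase l x)).

Let K : R := (2 * pi) ^- 2.

Lemma inv_area_gt0 : 0 < K.
Proof. by rewrite invr_gt0 exprn_gt0// mulr_gt0 ?pi_gt0. Qed.

Lemma inv_area_mul : K * (2 * pi) ^+ 2 = 1.
Proof. by rewrite mulVf// expf_neq0// mulf_neq0// ?gt_eqF ?pi_gt0. Qed.

Lemma bounded_sqint f (M : R) : mfun2 f -> (forall x, `|f x| <= M) ->
  sqint mu2 (Omega : set (plane R)) f.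
Proof.
move=> mf fM; apply: integrable_mul_sqint; first exact: mfun2D.
apply: (@bounded2_integrable _ (fun x => f x * f x)).
  by apply: measurable_funM; exact: mf.
exists (M * M) => x _; rewrite normrM.
by have := fM x; have := normr_ge0 (f x); nra.
Qed.

Lemma sqint_cos l : sqint mu2 (Omega : set (plane R)) (fun x => cos (phase l x)).
Proof. by apply: (@bounded_sqint _ 1); [exact: mfun2_cos|move=> x; exact: normr_cos_le1]. Qed.

Lemma sqint_sin l : sqint mu2 (Omega : set (plane R)) (fun x => sin (phase l x)).
Proof. by apply: (@bounded_sqint _ 1); [exact: mfun2_sin|move=> x; exact: normr_sin_le1]. Qed.

Lemma intble_mulcos f l : L2fun f -> intble (fun x => f x * cos (phase l x)).
Proof.
move=> /L2fun_sqint sf.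
exact: (sqint_integrable_mul measurable_Omega sf (sqint_cos l)).
Qed.

Lemma intble_mulsin f l : L2fun f -> intble (fun x => f x * sin (phase l x)).
Proof.
move=> /L2fun_sqint sf.
exact: (sqint_integrable_mul measurable_Omega sf (sqint_sin l)).
Qed.

(** Reduces complex Fourier coefficients to the real cosine and sine integrals
    of [f], on which all the estimates are made. *)
Lemma fourierE f l : intble (fun x => f x * sin (phase l x)) ->
  fourier f l = (K * ccoef f l) +i* (- (K * scoef f l)).
Proof.
move=> fi; rewrite /fourier /=.
have -> : (fun x : R * R => complex.Re ((f x)%:C * expi (- phase l x))) =
    (fun x => f x * cos (phase l x)).
  by apply/funext => x; rewrite /expi /= cosN mul0r subr0.
have -> : (fun x : R * R => complex.Im ((f x)%:C * expi (- phase l x))) =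
    (fun x => -1 * (f x * sin (phase l x))).
  by apply/funext => x; rewrite /expi /= sinN mul0r addr0; ring.
rewrite intOmegaZ// -/(ccoef f l) -/(scoef f l).
by apply/eqP; rewrite eq_complex /= -/K; apply/andP; split; apply/eqP; ring.
Qed.

Lemma normc_fourier f l : intble (fun x => f x * sin (phase l x)) ->
  ComplexField.Normc.normc (fourier f l) ^+ 2 =
  K ^+ 2 * (ccoef f l ^+ 2 + scoef f l ^+ 2).
Proof.
move=> /fourierE ->; rewrite /ComplexField.Normc.normc sqr_sqrtr; first by ring.
by rewrite addr_ge0 ?sqr_ge0.
Qed.

Lemma phaseB (l m : int * int) (x : R * R) : phase (l - m) x = phase l x - phase m x.
Proof. by rewrite /phase /= !rmorphB /=; ring. Qed.

(** With [z_l] the Fourier coefficients of [f] and [P + i Q] the sum of the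
    [z_l exp(i phase l)] over [r], the integral of [|f - (P + i Q)|^2] is
    nonnegative.  Products of modes are modes of the difference of the
    frequencies, so the double sum reduces to its diagonal. *)
Lemma Bessel f (r : seq (int * int)) : L2fun f -> uniq r ->
  \sum_(l <- r) (ccoef f l ^+ 2 + scoef f l ^+ 2) <=
  (2 * pi) ^+ 2 * intOmega (fun x => f x * f x).
Proof.
move=> Lf ur; set c := ccoef f; set s := scoef f; set Sg := \sum_(l <- r) _.
pose P x := \sum_(l <- r) (K * (c l * cos (phase l x) + s l * sin (phase l x))).
pose Q x := \sum_(l <- r) (K * (c l * sin (phase l x) - s l * cos (phase l x))).
have sf := L2fun_sqint Lf.
have If2 : intble (fun x => f x * f x) by exact: (sqint_integrable_mul measurable_Omega sf sf).
pose G l x := K * (c l * (f x * cos (phase l x)) + s l * (f x * sin (phase l x))).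
pose W l m x := K ^+ 2 * ((c l * c m + s l * s m) * cos (phase (l - m) x)
                    + (s l * c m - c l * s m) * sin (phase (l - m) x)).
have IG l : intble (G l).
  by apply: intbleZ; apply: intbleD; apply: intbleZ; [exact: intble_mulcos|exact: intble_mulsin].
have IW l m : intble (W l m).
  by apply: intbleZ; apply: intbleD; apply: intbleZ; [exact: intble_cos|exact: intble_sin].
have E : (fun x => (f x - P x) ^+ 2 + Q x ^+ 2) =
   (fun x => (f x * f x + - 2 * \sum_(l <- r) G l x) + \sum_(l <- r) \sum_(m <- r) W l m x).
  apply/funext => x.
  have -> : \sum_(l <- r) G l x = f x * P x.
    by rewrite /P mulr_sumr; apply: eq_bigr => l _; rewrite /G; ring.
  have -> : \sum_(l <- r) \sum_(m <- r) W l m x = P x * P x + Q x * Q x.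
    rewrite /P /Q !big_distrlr -big_split /=; apply: eq_bigr => l _.
    rewrite -big_split /=; apply: eq_bigr => m _.
    by rewrite /W phaseB cosB sinB; ring.
  by ring.
have IWW l : intble (fun x => \sum_(m <- r) W l m x) by exact: intble_sum.
have vG l : intOmega (G l) = K * (c l ^+ 2 + s l ^+ 2).
  rewrite /G intOmegaZ; last first.
    by apply: intbleD; apply: intbleZ; [exact: intble_mulcos|exact: intble_mulsin].
  rewrite intOmegaD.
  - rewrite !intOmegaZ; [|exact: intble_mulsin|exact: intble_mulcos].
    by rewrite -/(ccoef f l) -/(scoef f l) -/c -/s; ring.
  - by apply: intbleZ; exact: intble_mulcos.
  - by apply: intbleZ; exact: intble_mulsin.
have vW l m : intOmega (W l m) = if m == l then K * (c l ^+ 2 + s l ^+ 2) else 0.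
  rewrite /W intOmegaZ; last first.
    by apply: intbleD; apply: intbleZ; [exact: intble_cos|exact: intble_sin].
  rewrite intOmegaD; first last.
  - by apply: intbleZ; exact: intble_sin.
  - by apply: intbleZ; exact: intble_cos.
  rewrite !intOmegaZ; [|exact: intble_sin|exact: intble_cos].
  rewrite intOmega_sin mulr0 addr0; have [->|ml] := eqVneq m l.
    rewrite subrr intOmega_cos0.
    transitivity ((K * (2 * pi) ^+ 2) * (K * (c l * c l + s l * s l))); first by ring.
    by rewrite inv_area_mul; ring.
  by rewrite intOmega_cos ?mulr0// subr_eq0 eq_sym.
have vWW : \sum_(l <- r) intOmega (fun x => \sum_(m <- r) W l m x) = K * Sg.
  rewrite /Sg mulr_sumr big_seq [RHS]big_seq; apply: eq_bigr => l lr.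
  rewrite intOmega_sum//; under eq_bigr do rewrite vW.
  rewrite (bigD1_seq l)//= eqxx big1 ?addr0// => m /negbTE.
  by move=> ->.
have : 0 <= intOmega (fun x => (f x - P x) ^+ 2 + Q x ^+ 2).
  by apply: Rintegral_ge0 => x _; rewrite addr_ge0 ?sqr_ge0.
have ISG : intble (fun x => \sum_(l <- r) G l x) by exact: intble_sum.
rewrite E intOmegaD; last 2 first.
- by apply: intbleD => //; exact: intbleZ.
- exact: intble_sum.
rewrite intOmegaD//; last exact: intbleZ.
rewrite intOmegaZ// !intOmega_sum// vWW.
under eq_bigr do rewrite vG.
rewrite -mulr_sumr -/Sg => H.
have {}H : K * Sg <= intOmega (fun x => f x * f x) by lra.
have p : 0 < (2 * pi : R) ^+ 2 by rewrite exprn_gt0// mulr_gt0 ?pi_gt0.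
have : (2 * pi) ^+ 2 * (K * Sg) <= (2 * pi) ^+ 2 * intOmega (fun x => f x * f x).
  by rewrite ler_pM2l.
by rewrite mulrA [_ * K]mulrC inv_area_mul mul1r.
Qed.

End Fourier.

(** * Negative Sobolev norms *)

Section Sobolev.
Context {R : realType}.
Implicit Types (f g h : R * R -> R) (u : @vfield R).

Let K : R := (2 * pi) ^- 2.

Definition mode_sq u (l : int * int) : R :=
  \sum_i ComplexField.Normc.normc (fourier (u i) l) ^+ 2.

Definition energy u : R := \sum_i intOmega (fun x => u i x * u i x).

Lemma mode_sq_ge0 u l : 0 <= mode_sq u l.
Proof. by apply: sumr_ge0 => i _; rewrite sqr_ge0. Qed.

Lemma mode_sqE u l : L2field u ->
  mode_sq u l = K ^+ 2 * \sum_i (ccoef (u i) l ^+ 2 + scoef (u i) l ^+ 2).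
Proof.
move=> Lu; rewrite mulr_sumr; apply: eq_bigr => i _.
by rewrite normc_fourier//; exact: intble_mulsin.
Qed.

Lemma freqsq_ge0 l : 0 <= freqsq l :> R.
Proof. by rewrite addr_ge0 ?sqr_ge0. Qed.

Lemma weight_ge0 (k : R) l u : 0 <= (1 + freqsq l) `^ k * mode_sq u l.
Proof. by rewrite mulr_ge0 ?powR_ge0 ?mode_sq_ge0. Qed.

Lemma sum_mode_sq_le u (r : seq (int * int)) : L2field u -> uniq r ->
  \sum_(l <- r) mode_sq u l <= K * energy u.
Proof.
move=> Lu ur; under eq_bigr do rewrite mode_sqE//.
rewrite -mulr_sumr exchange_big /= mulr_sumr /energy mulr_sumr; apply: ler_sum => i _.
rewrite expr2 -mulrA ler_pM2l ?inv_area_gt0//.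
apply: (le_trans (ler_wpM2l (ltW (@inv_area_gt0 R)) (Bessel (Lu i) ur))).
by rewrite mulrA inv_area_mul mul1r.
Qed.

Lemma esum_modes_le u k : L2field u -> k <= 0 ->
  (\esum_(l in [set: int * int]) ((1 + freqsq l) `^ k * mode_sq u l)%:E
   <= (K * energy u)%:E)%E.
Proof.
move=> Lu k0; apply: ge_ereal_sup => _ [F [finF _] <-].
rewrite fsbig_finite// sumEFin lee_fin.
apply: le_trans (sum_mode_sq_le Lu (fset_uniq (fset_set F))).
apply: ler_sum => l _; rewrite ler_piMl ?mode_sq_ge0//.
have w1 : 1 <= 1 + freqsq l :> R by rewrite lerDl freqsq_ge0.
by have := ler_powR w1 k0; rewrite powRr0.
Qed.

Lemma esum_modes_ge0 u k :
  (0 <= \esum_(l in [set: int * int]) ((1 + freqsq l) `^ k * mode_sq u l)%:E)%E.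
Proof. by apply: esum_ge0 => l _; rewrite lee_fin weight_ge0. Qed.

(** Bessel's inequality makes the norm finite, so that [fine] can be moved
    inside the square root. *)
Lemma Hnorm_fineE u k : L2field u -> k <= 0 ->
  fine (Hnorm k u) ^+ 2 = (2 * pi) ^+ 2 *
    fine (\esum_(l in [set: int * int]) ((1 + freqsq l) `^ k * mode_sq u l)%:E)%E.
Proof.
move=> Lu k0; rewrite /Hnorm.
have := esum_modes_le Lu k0.
have := esum_modes_ge0 u k.
case: (esum _ _) => [e| |]//; rewrite lee_fin => e0 _.
rewrite -EFinM poweR_EFin /= powR12_sqrt ?sqr_sqrtr//.
  by rewrite mulr_ge0// exprn_ge0// mulr_ge0 ?pi_ge0.
by rewrite mulr_ge0// exprn_ge0// mulr_ge0 ?pi_ge0.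
Qed.

Lemma Hnorm_ge_modes u k (r : seq (int * int)) : L2field u -> k <= 0 -> uniq r ->
  (2 * pi) ^+ 2 * (\sum_(l <- r) (1 + freqsq l) `^ k * mode_sq u l)
  <= fine (Hnorm k u) ^+ 2.
Proof.
move=> Lu k0 ur; rewrite Hnorm_fineE// ler_wpM2l ?exprn_ge0 ?mulr_ge0 ?pi_ge0//.
have := esum_modes_le Lu k0.
have := esum_modes_ge0 u k.
set e := esum _ _ => e0 e1.
have ef : e \is a fin_num by rewrite ge0_fin_numE// (le_lt_trans e1)// ltry.
rewrite -lee_fin fineK//; apply: esum_ge; exists [set` r].
  by split => //; exact: finite_seq.
by rewrite -fsbig_seq// sumEFin.
Qed.

Lemma Hnorm_le_energy u k : L2field u -> k <= 0 ->
  fine (Hnorm k u) ^+ 2 <= energy u.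
Proof.
move=> Lu k0; rewrite Hnorm_fineE//.
have := esum_modes_le Lu k0.
have := esum_modes_ge0 u k.
set e := esum _ _ => e0 e1.
have ef : e \is a fin_num by rewrite ge0_fin_numE// (le_lt_trans e1)// ltry.
move: e1; rewrite -(fineK ef) lee_fin => e1.
have := ler_wpM2l (exprn_ge0 2 (mulr_ge0 (ler0n R 2) (pi_ge0 R))) e1.
by rewrite mulrA [_ * K]mulrC inv_area_mul mul1r.
Qed.

End Sobolev.

(** * Low modes of the divergence *)

Section Modes.
Context {R : realType}.
Implicit Types (f g h : R * R -> R) (u : @vfield R).

Let K : R := (2 * pi) ^- 2.

(** The square of frequencies with both components in [[-n, n]]. *)
Definition grid (n : nat) : seq (int * int) :=
  [seq (Posz a - Posz n, Posz b - Posz n) | a <- iota 0 n.*2.+1, b <- iota 0 n.*2.+1].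

Lemma low_modes_sub_grid (N : R) : 0 <= N ->
  [set l | Num.sqrt (freqsq l) <= N] `<=` [set` grid (Num.truncn N)].
Proof.
move=> N0 [a b] /=; rewrite /freqsq /= => sN.
have le_trunc (c : int) : (c%:~R : R) ^+ 2 <= N ^+ 2 -> (`|c| <= Num.truncn N)%N.
  rewrite -real_normK ?num_real// ler_pXn2r ?nnegrE// => cN.
  by rewrite truncn_ge_nat// pmulrn abszE intr_norm.
have sq : a%:~R ^+ 2 + b%:~R ^+ 2 <= N ^+ 2 :> R.
  rewrite -[leLHS]sqr_sqrtr ?addr_ge0 ?sqr_ge0//.
  by rewrite ler_pXn2r ?nnegrE ?sqrtr_ge0.
have := le_trunc a; have := le_trunc b; set n := Num.truncn N.
have h1 := sqr_ge0 (a%:~R : R); have h2 := sqr_ge0 (b%:~R : R).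
move=> /(_ ltac:(lra)) bn /(_ ltac:(lra)) an.
apply/allpairsP; exists (absz (a + Posz n), absz (b + Posz n)); split.
- by rewrite mem_iota; move: an bn; clear; rewrite /=; lia.
- by rewrite mem_iota; move: an bn; clear; rewrite /=; lia.
- by congr pair; move: an bn; clear; rewrite /=; lia.
Qed.

Lemma size_grid n : size (grid n) = (n.*2.+1 * n.*2.+1)%N.
Proof. by rewrite size_allpairs !size_iota. Qed.

Lemma finite_low_modes (N : R) : 0 <= N ->
  finite_set [set l : int * int | Num.sqrt (freqsq l) <= N].
Proof. by move=> N0; apply: sub_finite_set (low_modes_sub_grid N0) _; exact: finite_seq. Qed.

Lemma card_low_modes (N : R) : 1 <= N ->
  (#|` fset_set [set l : int * int | Num.sqrt (freqsq l) <= N]|%fset)%:R <= 9 * N ^+ 2.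
Proof.
move=> N1; have N0 : 0 <= N by lra.
have tN : (Num.truncn N)%:R <= N by rewrite truncn_le.
apply: (@le_trans _ _ ((size (grid (Num.truncn N)))%:R)).
  rewrite ler_nat uniq_leq_size// ?fset_uniq// => l.
  rewrite in_fset_set; last exact: finite_low_modes.
  by move=> /set_mem lN; have := low_modes_sub_grid N0 lN.
rewrite size_grid natrM -addn1 natrD -muln2 natrM.
have t0 : 0 <= (Num.truncn N)%:R :> R by [].
(* (2 n + 1)^2 <= (3 N)^2, because n <= N and 1 <= N *)
nra.
Qed.

Lemma Re_sum (I : Type) (r : seq I) (F : I -> R[i]) :
  complex.Re (\sum_(i <- r) F i) = \sum_(i <- r) complex.Re (F i).
Proof.
elim: r => [|i r IH]; first by rewrite !big_nil.
by rewrite !big_cons -IH; case: (F i) => ? ?; case: (\sum_(j <- r) F j).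
Qed.

Lemma smooth_C1 f : smooth f -> [/\ continuous f,
  forall i x, derivable f x (evec i) & forall i, continuous (partial i f)].
Proof.
move=> sf; have [cf df] := sf [::]; split => // i.
by have [] := sf [:: i].
Qed.

Definition smooth_field u := forall i, smooth (u i).

Lemma intble_partial i f : L2fun f -> smooth f ->
  forall c, mfun2 c -> continuous c -> intble (fun x => partial i f x * c x).
Proof.
move=> [_ mf _] /smooth_C1[_ df cp] c mc cc; apply: intble_continuous.
  by apply: measurable_funM => //; exact: mfun2_partial.
by move=> x; apply: cvgM; [exact: cp|exact: cc].
Qed.

Lemma ccoef_divergence u l : L2field u -> smooth_field u ->
  ccoef (divergence u) l = \sum_i freq l i * scoef (u i) l.
Proof.
move=> Lu su; rewrite /ccoef /divergence.
rewrite (_ : (fun x => _) = (fun x => \sum_i partial i (u i) x * cos (phase l x))); last first.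
  by apply/funext => x; rewrite mulr_suml.
rewrite intOmega_sum => [|i]; last first.
  by apply: intble_partial => //; [exact: mfun2_cos|exact: continuous_cos_phase].
apply: eq_bigr => i _; have [cf df cp] := smooth_C1 (su i); have [pf mf _] := Lu i.
by rewrite intOmega_partial_cos//.
Qed.

Lemma scoef_divergence u l : L2field u -> smooth_field u ->
  scoef (divergence u) l = - \sum_i freq l i * ccoef (u i) l.
Proof.
move=> Lu su; rewrite /scoef /divergence.
rewrite (_ : (fun x => _) = (fun x => \sum_i partial i (u i) x * sin (phase l x))); last first.
  by apply/funext => x; rewrite mulr_suml.
rewrite intOmega_sum => [|i]; last first.
  by apply: intble_partial => //; [exact: mfun2_sin|exact: continuous_sin_phase].
rewrite -sumrN; apply: eq_bigr => i _.
have [cf df cp] := smooth_C1 (su i); have [pf mf _] := Lu i.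
by rewrite intOmega_partial_sin// mulNr.
Qed.

(** The Cauchy-Schwarz inequality for the product of [l] with the vector of
    Fourier coefficients; the defect is the square of the coefficients of the
    curl. *)
Lemma coef_divergence_le u l : L2field u -> smooth_field u ->
  (K * ccoef (divergence u) l) ^+ 2 + (K * scoef (divergence u) l) ^+ 2
  <= freqsq l * mode_sq u l.
Proof.
move=> Lu su; rewrite ccoef_divergence// scoef_divergence// mode_sqE//.
rewrite -/K !big_ord_recl !big_ord0 /= !addr0 /freqsq.
rewrite (_ : freq l ord0 = l.1%:~R)// (_ : freq l (lift ord0 ord0) = l.2%:~R)//.
set a := l.1%:~R; set b := l.2%:~R.
set s0 := scoef _ _; set s1 := scoef _ _; set c0 := ccoef _ _; set c1 := ccoef _ _.
have := sqr_ge0 (K * (a * s1 - b * s0)); have := sqr_ge0 (K * (a * c1 - b * c0)).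
nra.
Qed.

Lemma intble_divergence_sin u l : L2field u -> smooth_field u ->
  intble (fun x => divergence u x * sin (phase l x)).
Proof.
move=> Lu su.
rewrite (_ : (fun x => _) = (fun x => \sum_i partial i (u i) x * sin (phase l x))); last first.
  by apply/funext => x; rewrite mulr_suml.
apply: intble_sum => i.
by apply: intble_partial => //; [exact: mfun2_sin|exact: continuous_sin_phase].
Qed.

(** Young's inequality for the product of [t] and [a c + b s], the latter being
    at most the length of [(a, b)]. *)
Lemma young_cos_sin (a b c s t : R) : 0 < t -> c ^+ 2 + s ^+ 2 = 1 ->
  a * c + b * s <= t / 2 + (a ^+ 2 + b ^+ 2) / (2 * t).
Proof.
move=> t0 cs.
have -> : t / 2 + (a ^+ 2 + b ^+ 2) / (2 * t) = (t ^+ 2 + (a ^+ 2 + b ^+ 2)) / (2 * t).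
  by field; rewrite gt_eqF.
rewrite ler_pdivlMr ?mulr_gt0//.
have : (a * c + b * s) ^+ 2 <= a ^+ 2 + b ^+ 2.
  rewrite -[leRHS]mulr1 -cs; have := sqr_ge0 (a * s - b * c); nra.
have := sqr_ge0 (t - (a * c + b * s)); nra.
Qed.

(** Young's inequality on each of the [O(N^2)] modes, with parameter [N^2]: the
    first terms add up to [O(N^4)], and in the second ones the parameter cancels
    the factor [|l|^2 <= N^2] produced by the derivative, which leaves the
    [H^-alpha] norm at the cost of the largest inverse weight. *)
Lemma PN_divergence_le (alpha N : R) u x : 0 <= alpha -> 1 <= N ->
  L2field u -> smooth_field u ->
  PN N (divergence u) x <=
  9 / 2 * N ^+ 4 + (1 + N ^+ 2) `^ alpha * (K * fine (Hnorm (- alpha) u) ^+ 2) / 2.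
Proof.
move=> a0 N1 Lu su; have N0 : 0 < N by lra.
have fA := finite_low_modes (ltW N0).
rewrite /PN fsbig_finite// Re_sum; set r := fset_set _ : seq _.
have inr l : l \in r -> freqsq l <= N ^+ 2 :> R.
  rewrite in_fset_set// => /set_mem /= h; rewrite -[leLHS]sqr_sqrtr ?freqsq_ge0//.
  by rewrite ler_pXn2r // nnegrE ?sqrtr_ge0 // ltW.
have N20 : 0 < N ^+ 2 by rewrite exprn_gt0.
pose w l : R := (1 + freqsq l) `^ (- alpha) * mode_sq u l.
apply: (@le_trans _ _ (\sum_(l <- r) (N ^+ 2 / 2 + (1 + N ^+ 2) `^ alpha / 2 * w l))).
  rewrite big_seq [leRHS]big_seq; apply: ler_sum => l lr.
  rewrite fourierE; last exact: intble_divergence_sin.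
  rewrite /expi /= -/K mulNr opprK.
  apply: (le_trans (young_cos_sin _ _ N20 (cos2Dsin2 _))).
  rewrite lerD2l; apply: (@le_trans _ _ (mode_sq u l / 2)).
    rewrite ler_pdivrMr ?mulr_gt0//.
    have -> : mode_sq u l / 2 * (2 * N ^+ 2) = N ^+ 2 * mode_sq u l by field.
    apply: (le_trans (coef_divergence_le l Lu su)).
    by rewrite ler_wpM2r ?mode_sq_ge0 ?inr.
  rewrite mulrAC ler_wpM2r ?invr_ge0// /w mulrA.
  rewrite -[leLHS]mul1r ler_wpM2r ?mode_sq_ge0//.
  have l1 : 0 < 1 + freqsq l :> R by have := @freqsq_ge0 R l; lra.
  rewrite powRN ler_pdivlMr ?powR_gt0// mul1r.
  by apply: ge0_ler_powR; rewrite ?nnegrE ?(ltW l1) ?addr_ge0 ?(ltW N20)// lerD2l inr.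
rewrite big_split /=; apply: lerD.
  rewrite big_const_seq count_predT iter_addr addr0 -[_ *+ size r]mulr_natl.
  have := card_low_modes N1; rewrite -/r => h.
  have : (size r)%:R * (N ^+ 2 / 2) <= 9 * N ^+ 2 * (N ^+ 2 / 2).
    by rewrite ler_wpM2r// mulr_ge0 ?invr_ge0 ?(ltW N20).
  by lra.
have := Hnorm_ge_modes Lu (_ : - alpha <= 0) (fset_uniq (fset_set _)).
rewrite oppr_le0 => /(_ _ a0) h.
have {}h : \sum_(l <- r) w l <= K * fine (Hnorm (- alpha) u) ^+ 2.
  have := ler_wpM2l (ltW (@inv_area_gt0 R)) (h [set l : int * int | Num.sqrt (freqsq l) <= N]).
  by rewrite mulrA inv_area_mul mul1r.
rewrite -mulr_sumr [leRHS]mulrAC ler_wpM2l// mulr_ge0 ?powR_ge0 ?invr_ge0//.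
Qed.

End Modes.

(** * From integrability of the cutoff to the divergence condition *)

Section Monotone.
Import HBNNSimple.

(** The integral of a nonnegative function is a supremum over the simple functions
    below it, so it is monotone over arbitrary functions, in particular over
    the supremum in space of the low-mode divergence as a function of time. *)
Lemma ge0_le_integral_nonmeasurable d (T : measurableType d) (R : realType)
    (mu : {measure set T -> \bar R}) (A B : set T) (f g : T -> \bar R) :
  A `<=` B -> (forall x, A x -> (0 <= f x)%E) -> (forall x, B x -> (0 <= g x)%E) ->
  (forall x, A x -> (f x <= g x)%E) ->
  (\int[mu]_(x in A) f x <= \int[mu]_(x in B) g x)%E.
Proof.
move=> AB f0 g0 fg; rewrite !ge0_integralE//; apply: ge_ereal_sup => _ [h hf <-].
apply: ereal_sup_ubound; exists h => // x; apply: (le_trans (hf x)).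
rewrite /patch; case: ifPn => [|_].
  by move=> /set_mem Ax; rewrite mem_set ?fg//; exact: AB.
by case: ifPn => // /set_mem /g0.
Qed.
End Monotone.

Section Cutoff.
Context {R : realType}.

Lemma sup_pos_ge0 (f : R * R -> R) : (0 <= sup_pos f)%E.
Proof.
apply: (@le_trans _ _ (Num.max 0 (f (0, 0)))%:E); first by rewrite lee_fin le_max lexx.
apply: ereal_sup_ubound; exists (0, 0) => //.
by split; rewrite /= in_itv /= lexx mulr_ge0 ?pi_ge0.
Qed.

Variables (alpha C Nst : R).
Hypotheses (a0 : 0 <= alpha) (a2 : alpha < 2) (C0 : 0 < C) (CN : 1 <= C * Nst).

Let K : R := (2 * pi) ^- 2.

Local Notation N u t := (Nalpha alpha C Nst u t).
Local Notation h2 u t := (fine (Hnorm (- alpha) (u t)) ^+ 2).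

Lemma Nalpha_base_ge1 (u : @trajectory R) t : 1 <= C * (h2 u t + Nst).
Proof.
rewrite mulrDr; apply: (le_trans CN); rewrite lerDr.
by rewrite mulr_ge0 ?sqr_ge0 ?(ltW C0).
Qed.

Lemma Nalpha_ge1 (u : @trajectory R) t : 1 <= N u t.
Proof.
have p1 : 1 `^ (2 - alpha)^-1 = 1 :> R by rewrite powR1.
rewrite /Nalpha -[leLHS]p1; apply: ge0_ler_powR.
- by rewrite invr_ge0 subr_ge0 ltW.
- by rewrite nnegrE.
- by rewrite nnegrE; have := Nalpha_base_ge1 u t; lra.
- exact: Nalpha_base_ge1.
Qed.

(** The definition of the cutoff, solved for the norm. *)
Lemma Hnorm_le_Nalpha (u : @trajectory R) t : h2 u t <= N u t `^ (2 - alpha) / C.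
Proof.
rewrite /Nalpha -powRrM mulVf ?powRr1; first last.
- by rewrite gt_eqF// subr_gt0.
- by have := Nalpha_base_ge1 u t; lra.
rewrite ler_pdivlMr// mulrC ler_pM2l// lerDl.
by rewrite -(pmulr_rge0 _ C0) (le_trans ler01).
Qed.

(** The first term counts modes; the second one combines
    [1 + N^2 <= 2 N^2] with the bound of the norm by the cutoff. *)
Definition PN_const : R := 9 / 2 + 2 `^ alpha * K / (2 * C).

Lemma PN_const_ge0 : 0 <= PN_const.
Proof.
by rewrite addr_ge0// divr_ge0// ?mulr_ge0 ?powR_ge0 ?(ltW C0)// ltW// inv_area_gt0.
Qed.

(** The exponents of [N] add up to [2 alpha + (2 - alpha) = 2 + alpha <= 4]. *)
Lemma sup_pos_le (u : @trajectory R) t : L2field (u t) -> smooth_field (u t) ->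
  (sup_pos (PN (N u t) (divergence (u t))) <= (PN_const * N u t ^+ 4)%:E)%E.
Proof.
move=> Lu su; apply: ge_ereal_sup => _ [x _ <-]; rewrite lee_fin ge_max.
have N1 := Nalpha_ge1 u t; set n := N u t in N1 *.
have n0 : 0 < n by lra.
rewrite mulr_ge0 ?PN_const_ge0 ?exprn_ge0 ?(ltW n0)//=.
apply: (le_trans (PN_divergence_le x a0 N1 Lu su)).
rewrite /PN_const [leRHS]mulrDl lerD2l.
have w : (1 + n ^+ 2) `^ alpha <= 2 `^ alpha * n `^ (2 * alpha).
  rewrite -(powR_mulrn 2 (ltW n0)) in N1 *.
  rewrite powRrM -powRM// ?powR_ge0//; apply: ge0_ler_powR => //.
  - by rewrite nnegrE addr_ge0 ?powR_ge0.
  - by rewrite nnegrE mulr_ge0 ?powR_ge0.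
  have : 1 <= n `^ 2 by rewrite powR_mulrn ?(ltW n0)// exprn_ege1.
  lra.
have Kg : 0 < K by exact: inv_area_gt0.
have h : K * h2 u t <= K * (n `^ (2 - alpha) / C).
  by rewrite ler_pM2l//; exact: Hnorm_le_Nalpha.
have nn : n `^ (2 * alpha) * n `^ (2 - alpha) <= n ^+ 4.
  rewrite -powRD; last by rewrite (gt_eqF n0) implybT.
  by rewrite -powR_mulrn ?(ltW n0)//; apply: ler_powR => //; move: a2; lra.
apply: (@le_trans _ _ ((2 `^ alpha * n `^ (2 * alpha)) * (K * (n `^ (2 - alpha) / C)) / 2)).
  rewrite ler_wpM2r ?invr_ge0// ler_pM ?powR_ge0// mulr_ge0 ?sqr_ge0// ltW//.
rewrite (_ : _ / 2 = 2 `^ alpha * K / (2 * C) * (n `^ (2 * alpha) * n `^ (2 - alpha))); last first.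
  by field; rewrite gt_eqF.
by rewrite ler_wpM2l// divr_ge0// ?mulr_ge0 ?powR_ge0 ?(ltW C0)// ltW.
Qed.

Lemma divergence_condition_of_L4 (u : @trajectory R) (r : R) :
  (forall t, 0 < t -> t < r -> L2field (u t) /\ smooth_field (u t)) ->
  L4_until r%:E (Nalpha alpha C Nst u) ->
  divergence_condition alpha C Nst u r%:E.
Proof.
move=> reg /(_ r)[mN IN].
have DE : [set t : R | [/\ 0 < t, t < r & (t%:E < r%:E)%E]] = `]0, r[%classic.
  apply/seteqP; split=> t /=; rewrite in_itv /= lte_fin; first by case=> -> ->.
  by move=> /andP[].
rewrite DE in mN IN.
pose B := (\int[lebesgue_measure]_(t in `]0%R, r[)
  (PN_const * `|Nalpha alpha C Nst u t| ^+ 4)%:E)%E.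
have Bfin : (B < +oo)%E.
  rewrite /B; under eq_integral do rewrite EFinM.
  rewrite ge0_integralZl//; first by rewrite lte_mul_pinfty ?lee_fin ?PN_const_ge0.
  - by apply/measurable_EFinP; apply: measurable_funX; exact: measurableT_comp.
  - by rewrite lee_fin PN_const_ge0.
apply: le_lt_trans Bfin; apply: (@le_trans _ _ (ereal_sup
  [set (\int[lebesgue_measure]_(s in `]0%R, t[)
      sup_pos (PN (Nalpha alpha C Nst u s) (divergence (u s))))%E | t in [set t | t < r]])).
  (* the limit superior is bounded by the supremum over all times before r *)
  apply: ereal_inf_lbound; exists [set t | t < r] => //.
  exact: withinT.
apply: ge_ereal_sup => _ [t /= tr <-].
apply: ge0_le_integral_nonmeasurable => [s|s|s|s] /=; rewrite ?in_itv /=.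
- by move=> /andP[-> /lt_trans]; apply.
- by move=> _; exact: sup_pos_ge0.
- by move=> _; rewrite lee_fin mulr_ge0 ?PN_const_ge0 ?exprn_ge0.
- move=> /andP[s0 st]; have [Lu su] := reg s s0 (lt_trans st tr).
  rewrite ger0_norm; first exact: sup_pos_le.
  by have := Nalpha_ge1 u s; lra.
Qed.

End Cutoff.

(** * Weakly continuous curves: boundedness and measurability *)

Section WeakCurves.
Context {R : realType}.

(** Test fields that probe one component of a curve of fields. *)
Definition in_component (i : 'I_2) (f : R * R -> R) : @vfield R :=
  fun j => if j == i then f else fun=> 0.

Lemma in_component_L2 i f : L2fun f -> L2field (in_component i f).
Proof.
move=> Lf j; rewrite /in_component; case: eqP => // _; split => //.
by under eq_integral do rewrite expr0n /=; rewrite integral0.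
Qed.

Lemma sum_in_component (v : @vfield R) i f x :
  \sum_j v j x * in_component i f j x = v i x * f x.
Proof.
rewrite (bigD1 i)//= big1 ?addr0; first by rewrite /in_component eqxx.
by move=> j /negbTE ji; rewrite /in_component ji mulr0.
Qed.

Lemma L2fun_cos l : L2fun (fun x : R * R => cos (phase l x)).
Proof. by split; [exact: periodic2_cos|exact: mfun2_cos|exact: (sqint_cos l).2]. Qed.

Lemma L2fun_sin l : L2fun (fun x : R * R => sin (phase l x)).
Proof. by split; [exact: periodic2_sin|exact: mfun2_sin|exact: (sqint_sin l).2]. Qed.

Variables (u : @trajectory R).
Hypothesis wu : weakly_continuous u +oo%E.
Hypothesis Lu : forall t, 0 <= t -> L2field (u t).

Lemma weak_component i f : L2fun f ->
  {within [set t : R | 0 <= t], continuous (fun t => intOmega (fun x => u t i x * f x))}.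
Proof.
move=> Lf; have := wu (in_component_L2 i Lf).
rewrite (_ : [set t : R | 0 <= t /\ (t%:E < +oo)%E] = [set t : R | 0 <= t]); last first.
  by apply/seteqP; split=> t /=; [case|move=> t0; split; rewrite ?ltry].
rewrite (_ : (fun t => intOmega _) = (fun t => intOmega (fun x => u t i x * f x)))//.
apply/funext => t; congr intOmega; apply/funext => x.
exact: sum_in_component.
Qed.

Lemma weak_component_bounded i f (S : R) : 0 <= S -> L2fun f ->
  exists M, forall t, 0 <= t <= S -> `|intOmega (fun x => u t i x * f x)| <= M.
Proof.
move=> S0 Lf; have cw := @weak_component i f Lf.
have cn : {within `[0, S], continuous (fun t => `|intOmega (fun x => u t i x * f x)|)}.
  apply: (@continuous_subspaceW _ _ _ [set t : R | 0 <= t]).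
    by move=> t /=; rewrite in_itv /= => /andP[].
  by move=> t; apply: cvg_norm; exact: cw.
have [c _ cP] := EVT_max S0 cn.
by exists `|intOmega (fun x => u c i x * f x)| => t tS; apply: cP; rewrite in_itv.
Qed.

(** A weakly continuous curve is bounded against each test function on a compact
    time interval, hence bounded in norm by uniform boundedness. *)
Lemma energy_bounded (S : R) : 0 <= S ->
  exists M, forall t, 0 <= t <= S -> energy (u t) <= M.
Proof.
move=> S0.
have comp i : exists M, forall t, 0 <= t <= S -> intOmega (fun x => u t i x * u t i x) <= M.
  pose v (s : {t : R | 0 <= t <= S}) := u (sval s) i.
  have Lv s : L2fun (v s) by apply: Lu; case: s => t /= /andP[].
  have [|c j g sg|M MP] := @L2_uniform_boundedness _ (plane R) R mu2 Omega measurable_Omega _ v.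
  - by move=> s; exact: L2fun_sqint.
  - have Lg : L2fun g.
      split; last exact: sg.2.
      + move=> x; split; rewrite /g /fun_series; do 2 congr (_ _); apply/funext => n;
          congr EFin; apply: eq_bigr => k _; congr (_ * _);
          by have [pv _ _] := Lv (j k); have [] := pv x.
      + by apply: measurable_fun_series => k; have [] := Lv (j k).
    have [M MP] := @weak_component_bounded i g S S0 Lg.
    by exists M => -[t tS]; exact: MP.
  - by exists M => t tS; exact: (MP (exist _ t tS)).
have /choice[M MP] := comp; exists (\sum_i M i) => t tS.
by apply: ler_sum => i _; exact: MP.
Qed.

Variable S : R.
Let D : set R := `]0, S[.

Lemma measurable_weak i f : L2fun f ->
  measurable_fun D (fun t => intOmega (fun x => u t i x * f x)).
Proof.
move=> Lf; apply: subspace_continuous_measurable_fun; first exact: measurable_itv.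
apply: (@continuous_subspaceW _ _ _ [set t : R | 0 <= t]); last exact: weak_component.
by move=> t; rewrite /D /= in_itv /= => /andP[/ltW].
Qed.

(** Turns sums over frequencies into series, the form in which countable sums
    are known to be measurable. *)
Lemma int2_enumeration :
  exists e : nat -> int * int, set_bij [set: nat] [set: int * int] e.
Proof.
have : ([set: int * int] #= [set: nat])%card.
  apply: eq_card_nat; first exact: countableP.
  move=> /(finite_image (fun l => absz l.1)) fin; apply: infinite_nat.
  apply: sub_finite_set fin => n _; exists (Posz n, Posz 0) => //.
move=> /card_set_bijP[f [_ finj fsurj]].
have /choice[e eK] : forall n, exists l, f l = n.
  by move=> n; have [l _ fl] := fsurj n I; exists l.
exists e; split => // [m n _ _ emn|l _]; first by rewrite -(eK m) emn eK.
by exists (f l) => //; apply: finj; rewrite ?mem_set // eK.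
Qed.

Lemma measurable_mode_sq l : measurable_fun D (fun t => mode_sq (u t) l).
Proof.
apply: (eq_measurable_fun (fun t => ((2 * pi) ^- 2) ^+ 2 *
    \sum_i (ccoef (u t i) l ^+ 2 + scoef (u t i) l ^+ 2))).
  move=> t /set_mem; rewrite /D /= in_itv /= => /andP[t0 _]; rewrite mode_sqE//.
  exact: Lu (ltW t0).
apply: measurable_funM => //; apply: measurable_sum => i.
apply: measurable_funD; apply: measurable_funX.
  exact: measurable_weak (L2fun_cos l).
exact: measurable_weak (L2fun_sin l).
Qed.

(** Weak continuity makes every Fourier coefficient continuous in time, and the
    squared norm is a countable sum of their weighted squares. *)
Lemma measurable_Hnorm_sqr k : k <= 0 ->
  measurable_fun D (fun t => fine (Hnorm k (u t)) ^+ 2).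
Proof.
move=> k0; have [e eP] := int2_enumeration.
apply: (eq_measurable_fun (fun t => (2 * pi) ^+ 2 *
    fine (\sum_(0 <= n <oo) ((1 + freqsq (e n)) `^ k * mode_sq (u t) (e n))%:E)%E)).
  move=> t /set_mem; rewrite /D /= in_itv /= => /andP[t0 _].
  rewrite Hnorm_fineE//; last exact: Lu (ltW t0).
  rewrite (reindex_esum _ _ e _ eP) nneseries_esumT// => n.
  by rewrite lee_fin weight_ge0.
apply: measurable_funM => //; apply: (measurableT_comp (fine_measurable measurableT)).
apply: ge0_emeasurable_sum => n *; first by rewrite lee_fin weight_ge0.
by apply/measurable_EFinP; apply: measurable_funM => //; exact: measurable_mode_sq.
Qed.

End WeakCurves.

(** * Global regularity and the cutoff *)

(** The cutoff is an increasing function of the [H^-alpha] norm, which the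
    energy bounds on [[0, |S|]]. *)
Lemma L4_of_global (R : realType) (alpha C Nst : R) (u : @trajectory R) :
  0 <= alpha -> alpha < 2 -> 0 < C -> 1 <= C * Nst ->
  weakly_continuous u +oo%E -> (forall t, 0 <= t -> L2field (u t)) ->
  L4_until +oo%E (Nalpha alpha C Nst u).
Proof.
move=> a0 a2 C0 CN wu Lu S.
have -> : [set t : R | [/\ 0 < t, t < S & (t%:E < +oo)%E]] = `]0, S[%classic.
  apply/seteqP; split=> t /=; rewrite in_itv /=; first by case=> -> ->.
  by move=> /andP[-> ->]; rewrite ltry.
have Na0 : - alpha <= 0 by rewrite oppr_le0.
split.
  apply: (measurableT_comp (measurable_powR _)).
  apply: measurable_funM => //; apply: measurable_funD => //.
  exact: measurable_Hnorm_sqr.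
have [M MP] := energy_bounded wu Lu (normr_ge0 S).
pose B := (C * (M + Nst)) `^ (2 - alpha)^-1.
apply: (@le_lt_trans _ _ (\int[lebesgue_measure]_(t in `]0%R, S[) (B ^+ 4)%:E)%E).
  apply: ge0_le_integral_nonmeasurable => // t; rewrite /= in_itv /=.
    by move=> _; rewrite lee_fin exprn_ge0 ?powR_ge0.
  move=> /andP[t0 tS].
  have N1 := Nalpha_ge1 a2 C0 CN u t.
  rewrite lee_fin ler_pXn2r ?nnegrE ?powR_ge0//.
  rewrite ger0_norm ?(le_trans ler01 N1)//.
  have b1 := Nalpha_base_ge1 alpha C0 CN u t.
  have hM : C * (fine (Hnorm (- alpha) (u t)) ^+ 2 + Nst) <= C * (M + Nst).
    rewrite ler_pM2l// lerD2r (le_trans (Hnorm_le_energy (Lu t (ltW t0)) Na0))//.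
    by apply: MP; rewrite (ltW t0) (le_trans (ltW tS))// ler_norm.
  apply: ge0_ler_powR => //; rewrite ?nnegrE.
  - by rewrite invr_ge0 subr_ge0 ltW.
  - exact: le_trans ler01 b1.
  - exact: le_trans (le_trans ler01 b1) hM.
have L : (lebesgue_measure (`]0%R, S[%classic : set R) < +oo)%E.
  by rewrite lebesgue_measure_itv /=; case: ifP => _; rewrite ?ltry// -EFinB ltry.
rewrite integral_cst; last exact: measurable_itv.
by apply: lte_mul_pinfty => //; rewrite lee_fin exprn_ge0 ?powR_ge0.
Qed.

Unset Implicit Arguments.

Theorem theorem4p8 (R : realType) (lambda alpha C Nst : R)
    (u0 : @vfield R) (T : \bar R) (u : @trajectory R)
    (hlambda : 0 < lambda)
    (halpha0 : 0 <= alpha) (halpha2 : alpha < 2)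
    (hC : 0 < C) (hP : propertyP lambda alpha C)
    (hNst : 0 < Nst) (hCN : 1 <= C * Nst)
    (hu0 : L2field u0) (hcurl : curl_free u0)
    (hu : KS_maximal lambda u0 T u) :
  globally_regular T <-> L4_until T (Nalpha alpha C Nst u).
Proof.
have [[T0 [Lu _] wu _ eqs] _] := hu; split.
  rewrite /globally_regular => TE; rewrite TE in Lu wu *.
  by apply: L4_of_global => // t t0; apply: Lu; rewrite ?ltry.
case: T T0 hu Lu wu eqs => [r| |]// r0 hu Lu wu eqs L4.
have [+ _] := hP Nst u0 _ u hNst hCN hu0 hcurl hu; case=> //.
apply: (divergence_condition_of_L4 halpha0 halpha2 hC hCN) => // t t0 tr.
split; first by apply: Lu; rewrite ?lte_fin ?(ltW t0).
by move=> i; have [|sm _ _] := eqs t t0; rewrite ?lte_fin.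
Qed.
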